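(* Let $f:\mathbb{A}\to\mathbb{A}$ be a negative-torsion map or a positive-torsion map of the annulus $\mathbb{A}=\mathbb{T}\times\mathbb{R}$. Let $\gamma:\mathbb{T}\to\mathbb{A}$ be a $\mathcal{C}^1$ $f$-invariant essential curve. Then for every $s\in\mathbb{T}$ and for every integer $N\ge1$ it holds $$N\,\mathrm{Torsion}_N(f,\gamma(s),\gamma'(s))=\mathrm{Var}_\gamma(\gamma(s),\gamma(s_N)),$$ where $s_N\in\mathbb{T}$ is defined by $f^N\circ\gamma(s)=\gamma(s_N)$.
   Context: $\mathbb{T}=\mathbb{R}/\mathbb{Z}$, $\mathbb{A}=\mathbb{T}\times\mathbb{R}$ with the standard Riemannian metric and the standard trivialization of its tangent bundle ($T_x\mathbb{A}\cong\mathbb{R}^2$), with the counterclockwise orientation. $p:\mathbb{R}\to\mathbb{T}$ is the covering map, $\chi=(0,1)$. For non-zero vectors $u,v\in\mathbb{R}^2$, $\theta(u,v)\in\mathbb{T}$ is the oriented angle from $u$ to $v$, measured in turns (a full counterclockwise turn is $1$). An isotopy is an arc in $\mathrm{Diff}^1(\mathbb{A})$ continuous for the compact-open (weak) $\mathcal{C}^1$ topology. Let $f:\mathbb{A}\to\mathbb{A}$ be a $\mathcal{C}^1$ diffeomorphism isotopic to the identity, and $(f_t)_{t\in[0,1]}$ an isotopy with $f_0=\mathrm{Id}$, $f_1=f$; extend it to $t\in\mathbb{R}_+=[0,+\infty)$ by $f_t=f_{t-\lfloor t\rfloor}\circ f^{\lfloor t\rfloor}$, and write $I=(f_t)_{t\ge0}$.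 For $x\in\mathbb{A}$ and $\xi\in T_x\mathbb{A}\setminus\{0\}$ let $\tilde v(I,x,\xi):\mathbb{R}_+\to\mathbb{R}$ be a continuous lift of $t\mapsto\theta(\chi,Df_t(x)\xi)\in\mathbb{T}$. For an integer $n\ge1$, $$\mathrm{Torsion}_n(f,x,\xi)=\frac{\tilde v(I,x,\xi)(n)-\tilde v(I,x,\xi)(0)}{n}.$$ This does not depend on the lift nor on the chosen isotopy. A negative-torsion (resp. positive-torsion) map is a $\mathcal{C}^1$ diffeomorphism $f:\mathbb{A}\to\mathbb{A}$ isotopic to the identity such that $\mathrm{Torsion}_1(f,z,\chi)<0$ (resp. $>0$) for every $z\in\mathbb{A}$. An essential curve is a $\mathcal{C}^0$ embedded circle $\gamma:\mathbb{T}\to\mathbb{A}$ not homotopic to a point; it is a $\mathcal{C}^1$ essential curve if $\gamma$ is moreover a $\mathcal{C}^1$ embedding (so $\gamma'(s)\neq0$ for all $s$). It is $f$-invariant if $f(\gamma(\mathbb{T}))=\gamma(\mathbb{T})$. Angle variation along $\gamma$: let $x=\gamma(a)$, $y=\gamma(b)$ with $a,b\in\mathbb{T}$. Fix a lift $A\in\mathbb{R}$ of $a$ and let $B$ be the lift of $b$ in $(A,A+1]$. Let $\tilde\Theta(\gamma,A):[0,+\infty)\to\mathbb{R}$ be a continuous lift of $t\mapsto\theta(\chi,\gamma'(p(A+t)))\in\mathbb{T}$. Then $\mathrm{Var}_\gamma(x,y):=\tilde\Theta(\gamma,A)(B-A)-\tilde\Theta(\gamma,A)(0)$, independent of the choice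 of lifts. *)

(* Defs.v *)
From HB Require Import structures.
From mathcomp Require Import all_boot all_order all_algebra generic_quotient.
From mathcomp Require Import all_classical all_reals all_analysis.

Set Implicit Arguments.
Unset Strict Implicit.
Unset Printing Implicit Defensive.

Import Order.TTheory GRing.Theory Num.Theory.
Import numFieldTopology.Exports numFieldNormedType.Exports.

Local Open Scope classical_set_scope.
Local Open Scope ring_scope.

Section Annulus.
Context (R : realType).

Definition eq_mod1 : rel R := fun x y => x - y \is a Num.int.

Lemma eq_mod1_refl : reflexive eq_mod1.
Proof. by move=> x; rewrite /eq_mod1 subrr rpred0. Qed.

Lemma eq_mod1_sym : symmetric eq_mod1.
Proof. by move=> x y; rewrite /eq_mod1 -opprB rpredN. Qed.

Lemma eq_mod1_trans : transitive eq_mod1.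
Proof. by move=> y x z xy yz; rewrite /eq_mod1 -(subrKA y) rpredD. Qed.

Definition equiv_mod1 :=
  EquivRel eq_mod1 eq_mod1_refl eq_mod1_sym eq_mod1_trans.

Definition circle : topologicalType :=
  quotient_topology {eq_quot equiv_mod1}%qT.

Definition circle_proj (x : R) : circle := (\pi_circle x)%qT.

Definition annulus : topologicalType := (circle * R)%type.

Definition plane : normedModType R := (R * R)%type.

Definition annulus_proj (u : plane) : annulus := (circle_proj u.1, u.2).

Definition chi : plane := (0, 1).

(* Counterclockwise rotation by [a] turns. *)
Definition rotation (a : R) (u : plane) : plane :=
  (cos (2 * pi * a) * u.1 - sin (2 * pi * a) * u.2,
   sin (2 * pi * a) * u.1 + cos (2 * pi * a) * u.2).

(* Meaningful for nonzero [u] and [v]; [a] is then unique modulo 1. *)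
Definition theta (u v : plane) : circle :=
  xget (circle_proj 0)
    [set circle_proj a | a in
      [set a | exists2 r : R, 0 < r & v = r *: rotation a u]].

(* The local inverses of [annulus_proj] are the charts of the annulus, and
   they induce the standard trivialization of its tangent bundle.  Thus [L] is
   the differential of [f] at [x] when some local lift [F] of [f] through
   [annulus_proj] has differential [L] at a point over [x].  Two such lifts
   differ by integer translations, so [L] is unique. *)
Definition is_annulus_diff (f : annulus -> annulus) (x : annulus)
    (L : plane -> plane) : Prop :=
  exists (u : plane) (F : plane -> plane),
    [/\ annulus_proj u = x,
        \forall v \near u, annulus_proj (F v) = f (annulus_proj v)
      & is_diff u F L].

Definition annulus_diff (f : annulus -> annulus) (x : annulus) :
    plane -> plane :=
  xget (fun=> 0) [set L | is_annulus_diff f x L].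

Definition annulus_C1 (f : annulus -> annulus) : Prop :=
  (forall x, exists L, is_annulus_diff f x L) /\
  (forall xi, continuous (fun x => annulus_diff f x xi)).

Definition C1_diffeo (f : annulus -> annulus) : Prop :=
  annulus_C1 f /\
  exists g, [/\ annulus_C1 g, cancel f g & cancel g f].

(* The last two conditions are continuity for the weak C^1 topology: the maps
   and, in the global trivialization of the tangent bundle, their
   differentials vary continuously for the compact-open topology. *)
Definition isotopy_to (f : annulus -> annulus) (I : R -> annulus -> annulus) :
    Prop :=
  [/\ forall t, t \in `[0, 1] -> C1_diffeo (I t),
      I 0 = id,
      I 1 = f,
      {within `[0, 1], continuous (I : R -> {compact-open, annulus -> annulus})}
    & forall xi : plane,
      {within `[0, 1], continuous ((fun t x => annulus_diff (I t) x xi)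
                                   : R -> {compact-open, annulus -> plane})}].

Definition isotopic_to_id (f : annulus -> annulus) : Prop :=
  exists I, isotopy_to f I.

Definition extended_isotopy (I : R -> annulus -> annulus) (t : R) :
    annulus -> annulus :=
  I (t - (Num.truncn t)%:R) \o iter (Num.truncn t) (I 1).

Definition angle_lift (I : R -> annulus -> annulus) (x : annulus) (xi : plane)
    (v : R -> R) : Prop :=
  {within `[0, +oo[, continuous v} /\
  forall t, 0 <= t ->
    circle_proj (v t) = theta chi (annulus_diff (extended_isotopy I t) x xi).

(* The value depends neither on the isotopy nor on the lift. *)
Definition torsion (n : nat) (f : annulus -> annulus) (x : annulus)
    (xi : plane) : R :=
  xget 0 [set tau | exists (I : R -> annulus -> annulus) (v : R -> R),
    [/\ isotopy_to f I, angle_lift I x xi v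
      & tau = (v n%:R - v 0) / n%:R]].

Definition negative_torsion_map (f : annulus -> annulus) : Prop :=
  [/\ C1_diffeo f, isotopic_to_id f & forall z, torsion 1 f z chi < 0].

Definition positive_torsion_map (f : annulus -> annulus) : Prop :=
  [/\ C1_diffeo f, isotopic_to_id f & forall z, torsion 1 f z chi > 0].

Definition null_homotopic (gamma : circle -> annulus) : Prop :=
  exists (H : circle * R -> annulus) (c : annulus),
    [/\ {within [set z | z.2 \in `[0, 1]], continuous H},
        forall s, H (s, 0) = gamma s
      & forall s, H (s, 1) = c].

Definition C0_embedding (gamma : circle -> annulus) : Prop :=
  continuous gamma /\
  exists g : annulus -> circle,
    cancel gamma g /\ {within range gamma, continuous g}.

Definition essential_curve (gamma : circle -> annulus) : Prop :=
  C0_embedding gamma /\ ~ null_homotopic gamma.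

(* As for [is_annulus_diff], through a local lift of [gamma]. *)
Definition is_velocity (gamma : circle -> annulus) (s : circle) (w : plane) :
    Prop :=
  exists (a : R) (G : R -> plane),
    [/\ circle_proj a = s,
        \forall t \near a, annulus_proj (G t) = gamma (circle_proj t)
      & is_derive a 1 G w].

Definition velocity (gamma : circle -> annulus) (s : circle) : plane :=
  xget 0 [set w | is_velocity gamma s w].

Definition C1_essential_curve (gamma : circle -> annulus) : Prop :=
  [/\ essential_curve gamma,
      forall s, exists w, is_velocity gamma s w,
      continuous (velocity gamma)
    & forall s, velocity gamma s != 0].

Definition invariant_curve (f : annulus -> annulus)
    (gamma : circle -> annulus) : Prop :=
  f @` range gamma = range gamma.

Definition tangent_angle_lift (gamma : circle -> annulus) (A : R)
    (Theta : R -> R) : Prop :=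
  {within `[0, +oo[, continuous Theta} /\
  forall t, 0 <= t ->
    circle_proj (Theta t) =
    theta chi (velocity gamma (circle_proj (A + t))).

(* For points of a C^1 essential curve, the value depends neither on [A] nor on
   the lift [Theta]. *)
Definition angle_variation (gamma : circle -> annulus) (x y : annulus) : R :=
  xget 0 [set d | exists (A B : R) (Theta : R -> R),
    [/\ gamma (circle_proj A) = x,
        gamma (circle_proj B) = y,
        A < B <= A + 1,
        tangent_angle_lift gamma A Theta
      & d = Theta (B - A) - Theta 0]].

End Annulus.

(* Main.v *)
(** Lift [gamma] to a plane curve [H]; then [H (a + 1) = H a + (k, 0)], and
    [k <> 0] because [gamma] is essential.  As [gamma] is injective, the chords
    [H (a + h) - H a] with [0 < h <= 1] never vanish; divided by [h], they
    extend continuously to the tangent vector at [h = 0].  Continuing along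
    them the constant angle of [(k, 0)], reached at [h = 1], gives the tangent
    vector at [a] a canonical real-valued angle [X a].  It is continuous and
    1-periodic in [a], so [Var_gamma] is a difference of values of [X].  The
    same construction applies to the curves [f_t o gamma], all with the same
    [k], and the canonical angle is continuous in [t].  Finally [f o gamma]
    is a reparametrization of [gamma], so its chords are chords of [gamma], and
    its canonical angle at [a] is [X a'] where [f (gamma a) = gamma a'].  Hence
    the isotopy from the identity to [f] rotates the tangent vector at [a] by
    exactly [X a' - X a], and these differences telescope along the orbit. *)

Require Import Defs.
From mathcomp Require Import all_boot all_order all_algebra generic_quotient.
From mathcomp Require Import all_classical all_reals all_analysis.
From mathcomp Require Import ring lra.

Set Implicit Arguments.
Unset Strict Implicit.
Unset Printing Implicit Defensive.

Import Order.TTheory GRing.Theory Num.Theory.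
Import numFieldTopology.Exports numFieldNormedType.Exports.

Local Open Scope classical_set_scope.
Local Open Scope ring_scope.

(** * Angles of plane vectors *)

Section Angle.
Context {R : realType}.
Implicit Types (a b r : R) (u v : plane R).

(** Real-valued counterpart of [theta (chi R) u]: [a] ranges over all real representatives of the
    angle, and no [a] is related to the zero vector. *)
Definition along a u := exists2 r, 0 < r & u = r *: rotation a (chi R).

Lemma plane_eqP u v : u = v <-> u.1 = v.1 /\ u.2 = v.2.
Proof. by case: u v => [u1 u2] [v1 v2]; split=> [[-> ->]|[/= -> ->]]. Qed.

Lemma along_coord a u : along a u <->
  exists2 r, 0 < r & u = (- (r * sin (2 * pi * a)), r * cos (2 * pi * a)).
Proof.
by split=> -[r r0 ->]; exists r => //; apply/plane_eqP; split;
   rewrite /rotation /chi /=; rewrite /GRing.scale /=; ring.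
Qed.

Lemma alongZ a u r : 0 < r -> along a u -> along a (r *: u).
Proof. by move=> r0 [q q0 ->]; exists (r * q); rewrite ?mulr_gt0// scalerA. Qed.

Lemma scaled_rotation_neq0 a r : 0 < r -> r *: rotation a (chi R) != 0.
Proof.
move=> r0; apply/eqP => /plane_eqP; rewrite /rotation /chi /= /GRing.scale /=.
rewrite !mulr0 !mulr1 add0r => -[/eqP]; rewrite mulf_eq0 oppr_eq0 gt_eqF //=.
move=> /eqP s0 /eqP; rewrite mulf_eq0 gt_eqF //= add0r => /eqP c0.
have := cos2Dsin2 (2 * pi * a).
by rewrite s0 c0 expr0n addr0 => /eqP; rewrite eq_sym oner_eq0.
Qed.

Lemma along_neq0 a u : along a u -> u != 0.
Proof. by case=> r r0 ->; exact: scaled_rotation_neq0. Qed.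

Lemma cos_2pi_int a : a \is a Num.int -> cos (2 * pi * a) = 1 /\ sin (2 * pi * a) = 0.
Proof.
have nat_case n : cos (2 * pi * n%:R : R) = 1 /\ sin (2 * pi * n%:R : R) = 0.
  elim: n => [|n [c s]]; first by rewrite mulr0 cos0 sin0.
  have -> : 2 * pi * n.+1%:R = 2 * pi * n%:R + pi *+ 2 :> R.
    by rewrite -[n.+1%:R]natr1 mulrDr mulr1 -[pi *+ 2]mulr_natl.
  by rewrite cosD2pi sinD2pi.
move=> /intrP[[n|n] ->]; first exact: nat_case.
rewrite NegzE mulrNz mulrN cosN sinN.
by have [-> ->] := nat_case n.+1; rewrite oppr0.
Qed.

(** Only the fractional part [b] of [a] matters, and cosine is injective on [[0, pi]]. *)
Lemma cos_2pi_eq1 a : cos (2 * pi * a) = 1 -> a \is a Num.int.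
Proof.
move=> c1; have pi0 := pi_gt0 R.
pose b := a - (Num.floor a)%:~R.
have [b0 b1] : 0 <= b /\ b < 1.
  by have /andP[] := floor_itv a; rewrite /b intrD1; lra.
have cb : cos (2 * pi * b) = 1.
  rewrite /b mulrBr cosB c1; have [|-> ->] := @cos_2pi_int (Num.floor a)%:~R.
    exact: intr_int.
  by rewrite mulr0 addr0 mulr1.
suff b_0 : b = 0 by have -> : a = (Num.floor a)%:~R by rewrite /b in b_0; lra.
have [bh|bh] := leP b (1/2).
  have : 2 * pi * b = 0.
    apply: cos_inj; rewrite ?cos0 ?cb ?in_itv //=; last by rewrite lexx ltW.
    by apply/andP; split; nra.
  by move/eqP; rewrite mulf_eq0 gt_eqF ?mulr_gt0//= => /eqP.
(* For [b > 1/2] the reflected angle [2 * pi * (1 - b)] lies in [[0, pi]]; it must vanish, which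
   contradicts [b < 1]. *)
have cb' : cos (2 * pi * (1 - b)) = 1.
  rewrite mulrBr cosB cb; have [|-> ->] := @cos_2pi_int 1; first exact: intr_int 1.
  by rewrite mul0r addr0 mulr1.
have : 2 * pi * (1 - b) = 0.
  apply: cos_inj; rewrite ?cos0 ?cb' ?in_itv //=; last by rewrite lexx ltW.
  by apply/andP; split; nra.
by move/eqP; rewrite mulf_eq0 gt_eqF ?mulr_gt0//= => /eqP; lra.
Qed.

(** Two polar forms of one vector have the same radius, hence the same sine and cosine, so the
    difference of the angles has cosine 1. *)
Lemma along_int a b u : along a u -> a - b \is a Num.int <-> along b u.
Proof.
move=> /along_coord[r r0 ua]; split.
  move=> ab; apply/along_coord; exists r => //; rewrite ua.
  have -> : 2 * pi * a = 2 * pi * b + 2 * pi * (a - b) :> R by ring.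
  by rewrite sinD cosD; have [-> ->] := cos_2pi_int ab; congr (_, _); ring.
move=> /along_coord[q q0]; rewrite ua => -[/oppr_inj sab cab].
apply: cos_2pi_eq1; rewrite mulrBr cosB.
have rq : r = q.
  have sqE (x y : R) :
      x ^+ 2 = (x * cos (2 * pi * y)) ^+ 2 + (x * sin (2 * pi * y)) ^+ 2.
    by rewrite !exprMn -mulrDr cos2Dsin2 mulr1.
  have : r ^+ 2 = q ^+ 2 by rewrite (sqE r a) (sqE q b) sab cab.
  by move=> /eqP; rewrite eqf_sqr => /orP[/eqP //|/eqP]; lra.
have qn0 : q != 0 by rewrite gt_eqF.
move: sab cab; rewrite rq => /(mulfI qn0) -> /(mulfI qn0) ->.
by rewrite -!expr2 cos2Dsin2.
Qed.

Lemma circle_projP a b : circle_proj a = circle_proj b <-> a - b \is a Num.int.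
Proof. exact: (rwP (@eqmodP _ (equiv_mod1 R) a b)). Qed.

(** The dot and cross products of [u] and [v] are proportional to the cosine and the sine of the
    angle from [u] to [v]; when the dot product is positive, this angle is the arctangent of their
    quotient. The formula is continuous in [u] and [v], which is what the construction of lifts
    uses. *)
Lemma along_step a u v : along a u -> 0 < u.1 * v.1 + u.2 * v.2 ->
  along (a + atan ((u.1 * v.2 - u.2 * v.1) / (u.1 * v.1 + u.2 * v.2)) / (2 * pi)) v.
Proof.
move=> /along_coord[r r0 ->] /=.
set s := sin _; set c := cos _; set p := _ + _ => p0.
have pi0 := pi_gt0 R.
set q := _ / p.
apply/along_coord.
have -> : 2 * pi * (a + atan q / (2 * pi)) = 2 * pi * a + atan q.
  by rewrite mulrDr [_ * (atan q / _)]mulrC divfK// mulf_neq0// gt_eqF.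
have c0 : 0 < cos (atan q).
  by apply: cos_gt0_pihalf; rewrite atan_gtNpi2 atan_ltpi2.
have sE : sin (atan q) = q * cos (atan q).
  exact: (canRL (divfK (lt0r_neq0 c0)) (atanK q)).
rewrite sinD cosD sE -/s -/c.
exists (p / (r * cos (atan q))); first by rewrite divr_gt0 ?mulr_gt0.
have rn0 : r != 0 by rewrite gt_eqF.
have pn0 : p != 0 by rewrite gt_eqF.
have Cn0 : cos (atan q) != 0 by rewrite gt_eqF.
have c2 : c ^+ 2 = 1 - s ^+ 2 by rewrite -(cos2Dsin2 (2 * pi * a)) addrK.
set C := cos (atan q) in Cn0 *.
pose n := - (r * s) * v.2 - r * c * v.1; have qE : q = n / p by [].
have E1 : p / (r * C) * (s * C + c * (q * C)) = (p * s + n * c) / r.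
  by rewrite qE; field; rewrite rn0 Cn0 pn0.
have E2 : p / (r * C) * (c * C - s * (q * C)) = (p * c - n * s) / r.
  by rewrite qE; field; rewrite rn0 Cn0 pn0.
apply/plane_eqP; split => /=; rewrite ?E1 ?E2.
  transitivity (v.1 * (c ^+ 2 + s ^+ 2)); first by rewrite c2 subrK mulr1.
  by rewrite /p /n; field.
transitivity (v.2 * (c ^+ 2 + s ^+ 2)); first by rewrite c2 subrK mulr1.
by rewrite /p /n; field.
Qed.

(** Every nonzero vector makes an acute angle with some vector whose angle is already known. *)
Lemma along_exists u : u != 0 -> exists a, along a u.
Proof.
move=> u0; have pi0 := pi_gt0 R.
have chiA : along 0 (chi R).
  by apply/along_coord; exists 1 => //; rewrite !mulr0 cos0 sin0 mulr1 mulr0 oppr0.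
have down : along (1 / 2) (0, -1).
  apply/along_coord; exists 1 => //.
  have -> : 2 * pi * (1 / 2) = pi :> R by field.
  by rewrite cospi sinpi mulr0 mul1r oppr0.
have step a (v w : plane R) :
    along a v -> 0 < v.1 * w.1 + v.2 * w.2 -> exists b, along b w.
  by move=> av vw; eexists; exact: along_step av vw.
have [u2|u2|u2] := ltgtP u.2 0.
- by apply: (step _ _ _ down) => /=; lra.
- by apply: (step _ _ _ chiA) => /=; lra.
(* A horizontal vector is orthogonal to both vertical ones; it makes an acute angle with one of the
   two diagonals. *)
have [d diag] : exists d, along d ((1, 1) : plane R).
  by apply: (step _ _ _ chiA) => /=; lra.
have [d' diag'] : exists d, along d ((-1, 1) : plane R).
  by apply: (step _ _ _ chiA) => /=; lra.
have [u1|u1|u1] := ltgtP u.1 0.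
- by apply: (step _ _ _ diag') => /=; lra.
- by apply: (step _ _ _ diag) => /=; lra.
by move/eqP: u0; case; apply/plane_eqP.
Qed.

Lemma thetaP a u : u != 0 -> (theta (chi R) u = circle_proj a <-> along a u).
Proof.
move=> /along_exists[b bu].
have thE : theta (chi R) u = circle_proj b.
  apply: xget_unique; first by exists b.
  move=> _ [c cu <-]; apply/circle_projP; exact/(along_int _ cu).
by rewrite thE circle_projP; apply: along_int.
Qed.

End Angle.

(** * Lifting angles of continuous families *)

Section ContinuityRules.
Context {R : realType} {T : topologicalType}.
Implicit Types f g : T -> R.

Lemma continuous_fun_comp {S U : topologicalType} (h : T -> S) (k : S -> U) :
  continuous h -> continuous k -> continuous (fun t => k (h t)).
Proof. by move=> ch ck t; apply: continuous_comp; [exact: ch|exact: ck]. Qed.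

Lemma continuous_fun_fst {U V : topologicalType} (h : T -> U * V) :
  continuous h -> continuous (fun t => (h t).1).
Proof. by move=> ch t; apply: (cvg_comp _ _ (ch t)); exact: cvg_fst. Qed.

Lemma continuous_fun_snd {U V : topologicalType} (h : T -> U * V) :
  continuous h -> continuous (fun t => (h t).2).
Proof. by move=> ch t; apply: (cvg_comp _ _ (ch t)); exact: cvg_snd. Qed.

Lemma continuous_fun_pair {U V : topologicalType} (h : T -> U) (k : T -> V) :
  continuous h -> continuous k -> continuous (fun t => (h t, k t)).
Proof. by move=> ch ck t; apply: cvg_pair; [exact: ch|exact: ck]. Qed.

Lemma continuous_funD f g :
  continuous f -> continuous g -> continuous (fun t => f t + g t).
Proof. by move=> cf cg t; apply: cvgD; [exact: cf|exact: cg]. Qed.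

Lemma continuous_funN f : continuous f -> continuous (fun t => - f t).
Proof. by move=> cf t; apply: cvgN; exact: cf. Qed.

Lemma continuous_funB f g :
  continuous f -> continuous g -> continuous (fun t => f t - g t).
Proof. by move=> cf cg; apply: continuous_funD => //; exact: continuous_funN. Qed.

Lemma continuous_funM f g :
  continuous f -> continuous g -> continuous (fun t => f t * g t).
Proof. by move=> cf cg t; apply: cvgM; [exact: cf|exact: cg]. Qed.

Lemma continuous_funZ {V : normedModType R} f (g : T -> V) :
  continuous f -> continuous g -> continuous (fun t => f t *: g t).
Proof. by move=> cf cg t; apply: cvgZ; [exact: cf|exact: cg]. Qed.

Lemma continuous_funV f : (forall t, f t != 0) ->
  continuous f -> continuous (fun t => (f t)^-1).
Proof. by move=> f0 cf t; apply: cvgV => //; exact: cf. Qed.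

Lemma continuous_funmax f g :
  continuous f -> continuous g -> continuous (fun t => Num.max (f t) (g t)).
Proof. by move=> cf cg t; apply: (@continuous_max R T f g); [exact: cf|exact: cg]. Qed.

Lemma continuous_funmin f g :
  continuous f -> continuous g -> continuous (fun t => Num.min (f t) (g t)).
Proof. by move=> cf cg t; apply: (@continuous_min R T f g); [exact: cf|exact: cg]. Qed.

Lemma continuous_fun_cst {U : topologicalType} (c : U) : continuous (fun _ : T => c).
Proof. by move=> t; exact: cvg_cst. Qed.

Lemma continuous_fun_id : continuous (fun t : T => t).
Proof. by move=> t; exact: cvg_id. Qed.

Lemma continuous_pairl {U : topologicalType} (c : U) :
  continuous (fun t : T => (t, c)).
Proof.
by apply: continuous_fun_pair; [exact: continuous_fun_id|exact: continuous_fun_cst].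
Qed.

Lemma continuous_pairr {U : topologicalType} (c : U) :
  continuous (fun t : T => (c, t)).
Proof.
by apply: continuous_fun_pair; [exact: continuous_fun_cst|exact: continuous_fun_id].
Qed.

End ContinuityRules.

Ltac cont := repeat lazymatch goal with
  | |- continuous (fun t => t) => exact: continuous_fun_id
  | |- continuous (fun t => (@?f t, @?g t)) => apply: continuous_fun_pair
  | |- continuous (fun t => @?f t + @?g t) => apply: continuous_funD
  | |- continuous (fun t => @?f t * @?g t) => apply: continuous_funM
  | |- continuous (fun t => - @?f t) => apply: continuous_funN
  | |- continuous (fun t => Num.max (@?f t) (@?g t)) => apply: continuous_funmax
  | |- continuous (fun t => Num.min (@?f t) (@?g t)) => apply: continuous_funmin
  | |- continuous (fun t => (@?f t).1) => apply: continuous_fun_fst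
  | |- continuous (fun t => (@?f t).2) => apply: continuous_fun_snd
  | |- continuous (pair ?c) =>
      apply: (continuous_fun_pair (continuous_fun_cst c) continuous_fun_id)
  | |- continuous fst => apply: (continuous_fun_fst continuous_fun_id)
  | |- continuous snd => apply: (continuous_fun_snd continuous_fun_id)
  | |- continuous (fun _ => ?c) => exact: continuous_fun_cst
  | |- _ => assumption
  end.

Section Lifting.
Context {R : realType}.
Implicit Types (a b : R -> R) (U : R * R -> plane R).

(** Retraction of the line onto [[-M, M]]: composing with it replaces continuity on a box by
    continuity on the whole plane. *)
Definition clamp (M x : R) : R := Num.max (- M) (Num.min x M).

Lemma clamp_itv M x : 0 <= M -> - M <= clamp M x <= M.
Proof. by move=> M0; rewrite /clamp le_max lexx ge_max ge_min lexx orbT andbT; lra. Qed.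

Lemma clamp_id M x : - M <= x <= M -> clamp M x = x.
Proof. by rewrite /clamp => /andP[Mx xM]; rewrite (min_l xM) (max_r Mx). Qed.

Lemma continuous_clamp M : continuous (clamp M).
Proof. have : continuous (fun x : R => Num.max (- M) (Num.min x M)) by cont.
by []. Qed.

(** By the intermediate value theorem, every value between [a 0] and [a 1] other than [a 0] is an
    integer. Integrality is asked only for [t > 0], so the lemma also covers chords, which
    degenerate to tangent vectors at 0. *)
Lemma int_valued_endpoints a : {within `[0, 1], continuous a} ->
  (forall t, 0 < t <= 1 -> a t \is a Num.int) -> a 0 = a 1.
Proof.
move=> ca aint.
have h v : Num.min (a 0) (a 1) <= v <= Num.max (a 0) (a 1) -> v != a 0 -> v \is a Num.int.
  move=> vI v0; have [c] := IVT ler01 ca vI.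
  rewrite in_itv /= => /andP[c0 c1] cv; rewrite -cv; apply: aint.
  by rewrite c1 lt_neqAle c0 !andbT eq_sym; apply: contra_neq v0 => <-.
have a1 : a 1 \is a Num.int by apply: aint; rewrite lexx ltr01.
have contra v : v \is a Num.int -> 0 < `|a 1 - v| < 1 -> False.
  move=> vi /andP[v0 v1]; have := @norm_intr_ge1 _ (a 1 - v).
  by rewrite rpredB// -normr_gt0 v0 => /(_ isT isT); rewrite leNgt v1.
have [lt01|lt10|//] := ltgtP (a 0) (a 1).
  (* This value lies strictly between [a 0] and [a 1], at distance at most 1/2 from the integer
     [a 1]. *)
  exfalso; apply: (contra (Num.max ((a 0 + a 1) / 2) (a 1 - 1 / 2))).
    apply: h; last by rewrite neq_lt orbC lt_max; apply/orP; left; lra.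
    rewrite (min_l (ltW lt01)) (max_r (ltW lt01)).
    by case: (lerP ((a 0 + a 1) / 2) (a 1 - 1/2)) => ?; apply/andP; split; lra.
  by case: (lerP ((a 0 + a 1) / 2) (a 1 - 1/2)) => ?; rewrite gtr0_norm; lra.
exfalso; apply: (contra (Num.min ((a 0 + a 1) / 2) (a 1 + 1 / 2))).
  apply: h; last by rewrite neq_lt gt_min; apply/orP; left; apply/orP; left; lra.
  rewrite (min_r (ltW lt10)) (max_l (ltW lt10)).
  by case: (lerP ((a 0 + a 1) / 2) (a 1 + 1/2)) => ?; apply/andP; split; lra.
by case: (lerP ((a 0 + a 1) / 2) (a 1 + 1/2)) => ?; rewrite ltr0_norm; lra.
Qed.

Lemma lift_variation_uniq a b (u : R -> plane R) : continuous a -> continuous b ->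
  (forall t, 0 <= t <= 1 -> along (a t) (u t)) ->
  (forall t, 0 <= t <= 1 -> along (b t) (u t)) -> a 1 - a 0 = b 1 - b 0.
Proof.
move=> ca cb au bu.
suff : a 0 - b 0 = a 1 - b 1 by lra.
apply: (@int_valued_endpoints (fun t => a t - b t)).
  by apply: continuous_subspaceT; cont.
move=> t /andP[t0 t1]; have tI : 0 <= t <= 1 by rewrite (ltW t0).
by apply/(along_int _ (au t tI)); exact: bu.
Qed.

End Lifting.

(** * Angle lifts of nowhere zero vector fields on the plane *)

Section GlobalLift.
Context {R : realType}.
Implicit Types (M : R) (U : R * R -> plane R).

Definition box (M : R) : set (R * R) := `[- M, M]%classic `*` `[- M, M]%classic.

(** At [d = 0] the quantity [C] is the squared length of a nonzero vector. By compactness of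
    [[0, 1]] times the box it stays positive for all displacements smaller than a uniform [e], and
    [1/n < e] suffices. *)
Lemma subdivision U M : continuous U -> (forall z, U z != 0) ->
  exists2 n, (0 < n)%N & forall (z : R * R) (j : nat), box M z -> (j < n)%N ->
    0 < (U ((j%:R / n%:R) *: z)).1 * (U ((j.+1%:R / n%:R) *: z)).1
      + (U ((j%:R / n%:R) *: z)).2 * (U ((j.+1%:R / n%:R) *: z)).2.
Proof.
move=> cU U0.
pose dot (u v : plane R) := u.1 * v.1 + u.2 * v.2.
pose C (y : (R * (R * R)) * R) : R :=
  dot (U (y.1.1 *: y.1.2)) (U ((y.1.1 + y.2) *: y.1.2)).
have cC : continuous C.
  have c1 : continuous (fun y : (R * (R * R)) * R => y.1) by move=> y; exact: cvg_fst.
  have c2 : continuous (fun y : (R * (R * R)) * R => y.2) by move=> y; exact: cvg_snd.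
  have cS1 : continuous (fun y : (R * (R * R)) * R => U (y.1.1 *: y.1.2)).
    apply: continuous_fun_comp cU.
    apply: continuous_funZ; first exact: continuous_fun_fst c1.
    exact: continuous_fun_snd c1.
  have cS2 : continuous (fun y : (R * (R * R)) * R => U ((y.1.1 + y.2) *: y.1.2)).
    apply: continuous_fun_comp cU.
    apply: continuous_funZ; last exact: continuous_fun_snd c1.
    by apply: continuous_funD; [exact: continuous_fun_fst c1|exact: c2].
  by rewrite /C /dot; apply: continuous_funD; apply: continuous_funM;
    [exact: continuous_fun_fst cS1|exact: continuous_fun_fst cS2|
     exact: continuous_fun_snd cS1|exact: continuous_fun_snd cS2].
have cK : compact (`[0, 1]%classic `*` box M : set (R * (R * R))).
  by apply: compact_setX; [|apply: compact_setX]; exact: segment_compact.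
have := (compact_near_coveringP _).1 cK R (nbhs (0 : R)) (fun d x => 0 < C (x, d)) _.
case=> [[l z] _|e /= e0 he].
  have C0 : 0 < C (l, z, 0).
    rewrite /C /dot /= addr0 -!expr2.
    have := U0 (l *: z); case: (U _) => p q /= pq0.
    rewrite lt_neqAle addr_ge0 ?sqr_ge0// andbT eq_sym paddr_eq0 ?sqr_ge0//.
    by rewrite !sqrf_eq0; apply: contra pq0 => /andP[/eqP -> /eqP ->].
  have := cvgr_gt (C (l, z, 0)) (cC (l, z, 0)) 0 C0.
  by move=> /(_ (nbhs_filter _)); apply: (@filterS _ _ (nbhs_filter _)) => -[x d].
pose n := (Num.truncn e^-1).+1.
have n0 : 0 < n%:R :> R by rewrite ltr0n.
have ne : n%:R^-1 < e.
  by rewrite invf_plt ?posrE// truncnS_gt.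
exists n => // z j zM jn.
have := he n%:R^-1 _ (j%:R / n%:R, z) _.
rewrite /C /dot /=.
have -> : j%:R / n%:R + n%:R^-1 = j.+1%:R / n%:R :> R.
  by rewrite -[j.+1%:R]natr1 mulrDl mul1r.
apply.
  by rewrite /ball_ /= sub0r normrN gtr0_norm ?invr_gt0.
split=> //=; rewrite in_itv /= divr_ge0//= ler_pdivrMr// mul1r ler_nat.
exact: ltnW.
Qed.

(* On the segment from [0] to [z], cut into [n] equal pieces, consecutive values
   of [U] make acute angles; [a z] adds up the corresponding arctangents. *)
Lemma box_lift U M a0 : 0 <= M -> continuous U -> (forall z, U z != 0) ->
  along a0 (U 0) ->
  exists2 a : R * R -> R, continuous a & forall z, box M z -> along (a z) (U z).
Proof.
move=> M0 cU U0 a0U.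
have [n n0 dotU] := subdivision M cU U0.
(* The retraction [cl] onto the box makes the acute angle condition available at every point, so
   each partial sum is continuous on the whole plane. *)
pose cl (z : R * R) := (clamp M z.1, clamp M z.2).
have ccl : continuous cl.
  by apply: continuous_fun_pair; apply: continuous_fun_comp (@continuous_clamp R M); cont.
have clM z : box M (cl z) by split; rewrite /= in_itv /= clamp_itv.
have : forall j, (j <= n)%N -> exists2 a : R * R -> R, continuous a &
    forall z, along (a z) (U ((j%:R / n%:R) *: cl z)).
  elim=> [_|j IH jn].
    by exists (fun=> a0); [cont|move=> z; rewrite mul0r scale0r].
  have [a ca aU] := IH (ltnW jn).
  eexists; last by move=> z; apply: (along_step (aU z)); exact: dotU.
  have cUj k : continuous (fun z => U ((k%:R / n%:R) *: cl z)).
    apply: continuous_fun_comp cU.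
    by apply: continuous_funZ => //; cont.
  have := cUj j; have := cUj j.+1 => cj1 cj.
  apply: continuous_funD => //; apply: continuous_funM; last by cont.
  apply: continuous_fun_comp (@continuous_atan R).
  apply: continuous_funM; first by cont.
  apply: continuous_funV; last by cont.
  by move=> z; rewrite gt_eqF// dotU.
move=> /(_ n (leqnn n)) [a ca aU]; exists a => // z [zM1 zM2].
have := aU z; rewrite divff ?scale1r ?pnatr_eq0 -?lt0n// /cl.
by rewrite !clamp_id; case: z zM1 zM2.
Qed.

(** The lifts on growing boxes are normalized to the same value [a0] at the origin. Two of them
    agree on a common ball, because the variation of the angle along a radius is unique. *)
Lemma global_lift U : continuous U -> (forall z, U z != 0) ->
  exists2 a : R * R -> R, continuous a & forall z, along (a z) (U z).
Proof.
move=> cU U0; have [a0 a0U] := along_exists (U0 0).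
have /choice[A AP] (m : nat) : exists a : R * R -> R,
    [/\ continuous a, a 0 = a0 & forall z, `|z| <= m%:R -> along (a z) (U z)].
  have [a ca aU] := box_lift (ler0n R m) cU U0 a0U.
  have boxm z : `|z| <= m%:R -> box m%:R z.
    by rewrite prod_normE ge_max => /andP[z1 z2]; split; rewrite /= in_itv /= -ler_norml.
  exists (fun z => a z - (a 0 - a0)); split; first by cont.
    by rewrite subKr.
  move=> z zm; have az := aU z (boxm z zm).
  apply/(along_int _ az); rewrite subKr.
  by apply/(along_int _ (aU 0 _)) => //; apply: boxm; rewrite normr0.
have compat m m' z : `|z| <= m%:R -> `|z| <= m'%:R -> A m z = A m' z.
  move=> zm zm'.
  have cz : continuous (fun t : R => t *: z).
    by apply: continuous_funZ; cont.
  have [cm m0 mU] := AP m; have [cm' m0' mU'] := AP m'.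
  have tz t k : 0 <= t <= 1 -> `|z| <= k -> `|t *: z| <= k.
    move=> /andP[t0 t1]; apply: le_trans.
    by rewrite normrZ ger0_norm// ler_piMl.
  have := @lift_variation_uniq _ (fun t => A m (t *: z)) (fun t => A m' (t *: z))
    (fun t => U (t *: z)) _ _ _ _.
  rewrite !scale1r !scale0r m0 m0' => h; apply: (addIr (- a0)); apply: h.
  - exact: continuous_fun_comp cz cm.
  - exact: continuous_fun_comp cz cm'.
  - by move=> t tI; apply: mU; exact: tz.
  - by move=> t tI; apply: mU'; exact: tz.
have trunc_le z : `|z| <= (Num.truncn `|z|).+1%:R :> R by rewrite ltW// truncnS_gt.
exists (fun z => A (Num.truncn `|z|).+1 z); last first.
  by move=> z; have [_ _] := AP (Num.truncn `|z|).+1; apply.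
(* This [m] bounds the norm on a whole neighbourhood of [z], where the single continuous lift [A m]
   can replace the varying index. *)
move=> z; pose m := (Num.truncn (`|z| + 1)).+1.
have zm : \forall w \near z, `|w| <= m%:R.
  near=> w; apply: ltW; apply: lt_trans (truncnS_gt _).
  near: w; apply: (cvgr_lt `|z| (@norm_continuous _ _ z)).
  by rewrite ltrDl.
have [cm _ _] := AP m.
have fz : A (Num.truncn `|z|).+1 z = A m z.
  by apply: compat => //; exact: nbhs_singleton zm.
rewrite /continuous_at fz.
apply: cvg_trans (cm z); apply: near_eq_cvg.
by near=> w; apply: compat => //; near: w.
Unshelve. all: by end_near. Qed.

End GlobalLift.

(** * Local lifts and differentials *)

Section LocalLifts.
Context {R : realType}.
Implicit Types (a b r : R) (u v w : plane R).

Lemma near_all {T : topologicalType} (x : T) (P : T -> Prop) :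
  (forall y, P y) -> \forall y \near x, P y.
Proof. by move=> Px; exact: filterE. Qed.

Lemma int_valued_constant {V : normedModType R} (a : V -> R) : continuous a ->
  (forall x, a x \is a Num.int) -> forall x y, a x = a y.
Proof.
move=> ca aint x y.
pose p (t : R) := x + t *: (y - x).
have cp : continuous p.
  move=> t; apply: cvgD; first exact: cvg_cst.
  by apply: cvgZ; [exact: cvg_id|exact: cvg_cst].
have := @int_valued_endpoints R (fun t => a (p t)) _ (fun t _ => aint (p t)).
rewrite /p scale0r addr0 scale1r subrKC; apply.
exact: continuous_subspaceT (continuous_fun_comp cp ca).
Qed.

Lemma circle_projD a n : n \is a Num.int -> circle_proj (a + n) = circle_proj a.
Proof. by move=> ni; apply/circle_projP; rewrite addrC addKr. Qed.

Lemma annulus_projP u v : annulus_proj u = annulus_proj v <->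
  u.1 - v.1 \is a Num.int /\ u.2 = v.2.
Proof.
rewrite /annulus_proj; split=> [[/circle_projP ? ?] //|[uv ->]].
by congr (_, _); apply/circle_projP.
Qed.

Lemma continuous_circle_proj : continuous (@circle_proj R).
Proof. exact: pi_continuous. Qed.

Lemma continuous_annulus_proj : continuous (@annulus_proj R).
Proof.
apply: continuous_fun_pair; last by cont.
by apply: continuous_fun_comp continuous_circle_proj; cont.
Qed.

Lemma circle_projK (s : circle R) : exists a, circle_proj a = s.
Proof. by exists (repr s); rewrite /circle_proj reprK. Qed.

Lemma annulus_projK (x : annulus R) : exists u, annulus_proj u = x.
Proof.
by case: x => s y; have [a <-] := circle_projK s; exists (a, y).
Qed.

Lemma continuous_trig (h : R -> R) : continuous h ->
  continuous (fun t => cos (h t)) /\ continuous (fun t => sin (h t)).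
Proof.
by move=> ch; split; apply: continuous_fun_comp ch _;
  [exact: continuous_cos|exact: continuous_sin].
Qed.

(** The unit vector [e a] of angle [a] depends only on [a] modulo 1, so [c] turns into a field of
    unit vectors, and an angle lift of that field is a lift of [c]. *)
Lemma circle_lift (c : R * R -> circle R) : continuous c ->
  exists2 b : R * R -> R, continuous b & forall z, circle_proj (b z) = c z.
Proof.
move=> cc.
pose e (a : R) : plane R := (- sin (2 * pi * a), cos (2 * pi * a)).
have ce : continuous e.
  have h : continuous (fun a : R => 2 * pi * a) by cont.
  have [cco csi] := continuous_trig h.
  by apply: continuous_fun_pair => //; exact: continuous_funN.
have eA a : along a (e a).
  by apply/along_coord; exists 1 => //; rewrite !mul1r.
have e_int a b : a - b \is a Num.int -> e a = e b.
  move=> /cos_2pi_int; rewrite mulrBr cosB sinB => -[c1 s0].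
  have -> : e a = e (b + (a - b)) by congr e; ring.
  rewrite /e mulrDr sinD cosD mulrBr sinB cosB c1 s0.
  by rewrite !mulr0 !mulr1 addr0 subr0.
pose E (s : circle R) := e (repr s).
have EP a : E (circle_proj a) = e a.
  by apply: e_int; apply/circle_projP; rewrite /circle_proj reprK.
have cE : continuous E.
  apply/quotient_continuous; rewrite (_ : _ \o _ = e) //.
  by apply/funext => a; exact: EP.
have [b cb bE] := @global_lift R (fun z => E (c z)) (continuous_fun_comp cc cE)
  (fun z => along_neq0 (eA (repr (c z)))).
exists b => // z; have [a az] := circle_projK (c z); rewrite -az.
by apply/circle_projP/(along_int _ (bE z)); rewrite -az EP.
Qed.

Lemma annulus_lift (c : R * R -> annulus R) : continuous c ->
  exists2 G : R * R -> plane R, continuous G & forall z, annulus_proj (G z) = c z.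
Proof.
move=> cc; have [b cb bc] := circle_lift (continuous_fun_fst cc).
exists (fun z => (b z, (c z).2)); first by cont.
by move=> z; rewrite /annulus_proj /= bc; case: (c z).
Qed.

(** The first coordinates differ by an integer that moves by less than 1 near [x], hence not at all.
    Continuity at the single point [x] is what differentiability there provides. *)
Lemma near_lift_constant {T : topologicalType} (x : T) (F G : T -> plane R) :
  {for x, continuous F} -> {for x, continuous G} ->
  (\forall y \near x, annulus_proj (F y) = annulus_proj (G y)) ->
  \forall y \near x, F y = G y + (F x - G x).
Proof.
move=> cF cG FG.
have c1 : (F y).1 - (G y).1 @[y --> x] --> (F x).1 - (G x).1.
  by apply: cvgB; [apply: (cvg_comp _ _ cF)|apply: (cvg_comp _ _ cG)]; exact: cvg_fst.
have /annulus_projP[x1 x2] := nbhs_singleton FG.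
have near1 : \forall y \near x, `|((F x).1 - (G x).1) - ((F y).1 - (G y).1)| < 1.
  by have /cvgrPdist_lt := c1; apply.
near=> y.
have /annulus_projP[y1 y2] : annulus_proj (F y) = annulus_proj (G y) by near: y.
have : `|((F x).1 - (G x).1) - ((F y).1 - (G y).1)| < 1 by near: y.
have [/eqP e _|ne] := eqVneq ((F x).1 - (G x).1 - ((F y).1 - (G y).1)) 0.
  apply/plane_eqP; split=> /=.
    by move: e; rewrite subr_eq0 => /eqP ->; rewrite addrC subrK.
  by rewrite x2 subrr addr0.
by rewrite ltNge norm_intr_ge1// rpredB.
Unshelve. all: by end_near. Qed.

Lemma is_diff_near {V W : normedModType R} (f g : V -> W) x L :
  (\forall y \near x, f y = g y) -> is_diff x f L -> is_diff x g L.
Proof.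
move=> fg df; have dfx : differentiable f x by [].
have go : g \o shift x = cst (g x) + 'd f x +o_ 0 id.
  have /eqaddoP fo := diff_locally dfx.
  apply/eqaddoP => e e0.
  have fgs : \forall h \near 0, f (h + x) = g (h + x).
    by have := fg; rewrite (near_shift 0)/= subr0.
  apply: filterS2 fgs (fo e e0) => h fgh.
  by rewrite !fctE /= fgh (nbhs_singleton fg).
have cdf : continuous ('d f x) by exact: diff_continuous.
have dgE := diff_unique cdf go.
apply: DiffDef; last by rewrite dgE diff_val.
by apply/diff_locallyP; rewrite dgE.
Qed.

Lemma is_diff_linear {V W : normedModType R} (f : V -> W) x L :
  is_diff x f L -> forall (r : R) (u v : V), L (r *: u + v) = r *: L u + L v.
Proof.
move=> df r u v; have <- : 'd f x = L :> (V -> W) by exact: diff_val.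
exact: linearP. Qed.

Lemma is_diff_scale {V W : normedModType R} (f : V -> W) x L :
  is_diff x f L -> forall (r : R) (u : V), L (r *: u) = r *: L u.
Proof.
move=> /is_diff_linear lin r u.
have L0 : L 0 = 0 by have := lin (-1) 0 0; rewrite scaler0 addr0 scaleN1r addNr.
by have := lin r u 0; rewrite L0 !addr0.
Qed.

Lemma is_diff_fun0 {V W : normedModType R} (f : V -> W) x L :
  is_diff x f L -> L 0 = 0.
Proof. by move=> /is_diff_scale /(_ 0 0); rewrite !scale0r. Qed.

Lemma is_diff_shift {V W : normedModType R} (F : V -> W) (u0 u1 : V) (w : W) L :
  is_diff u1 F L -> is_diff u0 (fun x : V => F (x + (u1 - u0)) + w) L.
Proof.
move=> dF.
have d1 : is_diff u0 (id + cst (u1 - u0)) (id + 0 : V -> V) by exact: is_diffD.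
have d2 : is_diff ((id + cst (u1 - u0)) u0) F L by rewrite !fctE subrKC.
have d3 := is_diffD (is_diff_comp d1 d2) (is_diff_cst w u0).
by apply: (is_diff_eq d3); rewrite !addr0.
Qed.

Lemma is_diff_continuous {V W : normedModType R} (F : V -> W) (u : V) L :
  is_diff u F L -> {for u, continuous F}.
Proof. by move=> dF; exact: differentiable_continuous. Qed.

Implicit Types (f g : annulus R -> annulus R) (gamma : circle R -> annulus R).

Lemma annulus_proj_shift u0 u1 v : annulus_proj u0 = annulus_proj u1 ->
  annulus_proj (v + (u1 - u0)) = annulus_proj v.
Proof.
move=> /annulus_projP[i1 e2]; apply/annulus_projP => /=.
by rewrite addrC addKr -opprB rpredN e2 subrr addr0.
Qed.

(** The lift supplied by [is_annulus_diff] may sit over other representatives; deck translations in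
    the source and in the target bring it to [u0] and [w0] without changing its differential. *)
Lemma annulus_diff_local_lift f u0 w0 L :
  is_annulus_diff f (annulus_proj u0) L -> annulus_proj w0 = f (annulus_proj u0) ->
  exists F : plane R -> plane R, [/\ F u0 = w0,
    \forall v \near u0, annulus_proj (F v) = f (annulus_proj v) & is_diff u0 F L].
Proof.
move=> [u1 [F [u1u0 Ff dF]]] w0f.
exists (fun v => F (v + (u1 - u0)) + (w0 - F u1)); split.
- by rewrite !subrKC.
- have : \forall v \near u0,
      annulus_proj (F (v + (u1 - u0))) = f (annulus_proj (v + (u1 - u0))).
    by have := Ff; rewrite (near_shift u0)/=; apply: filterS => v /=.
  apply: filterS => v Fv.
  rewrite annulus_proj_shift.
    by rewrite Fv annulus_proj_shift.
  by rewrite (nbhs_singleton Ff) w0f u1u0.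
exact: is_diff_shift.
Qed.

(** Same normalization for curves. The velocity is restated as the linear map [h => h *: v], ready
    for the chain rule with differentials of maps. *)
Lemma velocity_local_lift gamma a0 w0 v :
  is_velocity gamma (circle_proj a0) v -> annulus_proj w0 = gamma (circle_proj a0) ->
  exists G : R -> plane R, [/\ G a0 = w0,
    \forall t \near a0, annulus_proj (G t) = gamma (circle_proj t)
    & is_diff a0 G (fun h => h *: v)].
Proof.
move=> [a1 [G [a1a0 Gg dG]]] w0g.
have {}dG : is_diff a1 G (fun h => h *: v).
  have Gd : derivable G a1 1 by [].
  apply: DiffDef; first exact/derivable1_diffP.
  by rewrite deriv1E// derive1E derive_val.
exists (fun t => G (t + (a1 - a0)) + (w0 - G a1)); split.
- by rewrite !subrKC.
- have : \forall t \near a0,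
      annulus_proj (G (t + (a1 - a0))) = gamma (circle_proj (t + (a1 - a0))).
    by have := Gg; rewrite (near_shift a0)/=; apply: filterS => t /=.
  apply: filterS => t Gt.
  rewrite annulus_proj_shift; last by rewrite (nbhs_singleton Gg) w0g a1a0.
  by rewrite Gt circle_projD//; exact/circle_projP.
exact: is_diff_shift.
Qed.

(** Near [a] a continuous lift differs by a constant from a differentiable one, so it is itself
    differentiable with the same derivative. *)
Lemma lift_is_diff gamma (G : R -> plane R) a v : {for a, continuous G} ->
  (\forall t \near a, annulus_proj (G t) = gamma (circle_proj t)) ->
  is_velocity gamma (circle_proj a) v -> is_diff a G (fun h => h *: v).
Proof.
move=> cG Gg vg.
have [G' [_ G'g dG']] := velocity_local_lift vg (nbhs_singleton Gg).
have := @near_lift_constant _ a G G' cG (is_diff_continuous dG') _.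
have GG' : \forall t \near a, annulus_proj (G t) = annulus_proj (G' t).
  by apply: filterS2 Gg G'g => t -> ->.
move=> /(_ GG') E; apply: (@is_diff_near _ _ (fun t => G' (t + (a - a)) + (G a - G' a))).
  by apply: filterS E => t ->; rewrite subrr addr0.
exact: is_diff_shift.
Qed.

Lemma is_velocity_lift gamma (G : R -> plane R) a v :
  (\forall t \near a, annulus_proj (G t) = gamma (circle_proj t)) ->
  is_diff a G (fun h => h *: v) -> is_velocity gamma (circle_proj a) v.
Proof.
move=> Gg dG; exists a, G; split => //.
have Gd : derivable G a 1 by apply/derivable1_diffP.
apply: DeriveDef => //.
have := deriv1E Gd; rewrite diff_val derive1E => /(congr1 (fun h => h 1)).
by rewrite !scale1r.
Qed.

Lemma is_velocity_uniq gamma s v w :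
  is_velocity gamma s v -> is_velocity gamma s w -> v = w.
Proof.
have [a <-] := circle_projK s => gv gw.
have [u ua] := annulus_projK (gamma (circle_proj a)).
have [G [_ Gg dG]] := velocity_local_lift gv ua.
have dG' := lift_is_diff (is_diff_continuous dG) Gg gw.
have : (fun h : R => h *: v) = (fun h : R => h *: w).
      have <- : 'd G a = (fun h : R => h *: v) :> (R -> plane R) by exact: diff_val.
  by rewrite diff_val.
by move=> /(congr1 (fun h => h 1)); rewrite !scale1r.
Qed.

Lemma velocityP gamma s v : is_velocity gamma s v -> velocity gamma s = v.
Proof. by move=> gv; apply: xget_unique => // w gw; exact: is_velocity_uniq gw gv. Qed.

Lemma is_annulus_diff_comp f g x L M : is_annulus_diff g x M ->
  is_annulus_diff f (g x) L -> is_annulus_diff (f \o g) x (L \o M).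
Proof.
have [u <-] := annulus_projK x; have [w wu] := annulus_projK (g (annulus_proj u)).
rewrite -wu => gM fL; have [z zw] := annulus_projK (f (annulus_proj w)).
have [G [Gu Gg dG]] := annulus_diff_local_lift gM wu.
have [F [Fw Ff dF]] := annulus_diff_local_lift fL zw.
exists u, (F \o G); split => //.
  have : \forall v \near u, annulus_proj (F (G v)) = f (annulus_proj (G v)).
    have cG : G v @[v --> u] --> w by rewrite -Gu; exact: is_diff_continuous dG.
    exact: (cG _ Ff).
  by apply: filterS2 Gg => v /= <- ->.
by rewrite -Gu in dF; exact: is_diff_comp.
Qed.

Lemma is_annulus_diff_uniq f x L M :
  is_annulus_diff f x L -> is_annulus_diff f x M -> L = M.
Proof.
have [u <-] := annulus_projK x; have [w wu] := annulus_projK (f (annulus_proj u)).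
move=> fL fM.
have [F [Fu Ff dF]] := annulus_diff_local_lift fL wu.
have [G [Gu Gg dG]] := annulus_diff_local_lift fM wu.
have FG : \forall v \near u, annulus_proj (F v) = annulus_proj (G v).
  by apply: filterS2 Ff Gg => t -> ->.
have E := near_lift_constant (is_diff_continuous dF) (is_diff_continuous dG) FG.
have {}E : \forall v \near u, F v = G v.
  by apply: filterS E => v ->; rewrite Fu Gu subrr addr0.
have dG' := is_diff_near E dF.
have <- : 'd G u = L :> (plane R -> plane R) by exact: diff_val.
exact: diff_val.
Qed.

Lemma annulus_diffP f x L : is_annulus_diff f x L -> annulus_diff f x = L.
Proof.
by move=> fL; apply: xget_unique => // M fM; exact: is_annulus_diff_uniq fM fL.
Qed.

Lemma is_annulus_diff_id (x : annulus R) : is_annulus_diff id x id.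
Proof.
have [u ux] := annulus_projK x; exists u, id.
by split; [|exact: near_all|exact: is_diff_id].
Qed.

Lemma is_velocity_comp f gamma s v L : is_velocity gamma s v ->
  is_annulus_diff f (gamma s) L -> is_velocity (f \o gamma) s (L v).
Proof.
have [a <-] := circle_projK s; have [u ua] := annulus_projK (gamma (circle_proj a)).
rewrite -ua => gv fL; have [w wu] := annulus_projK (f (annulus_proj u)).
have [G [Ga Gg dG]] := velocity_local_lift gv ua.
have [F [Fu Ff dF]] := annulus_diff_local_lift fL wu.
apply: (@is_velocity_lift _ (F \o G)).
  have : \forall t \near a, annulus_proj (F (G t)) = f (annulus_proj (G t)).
    have cG : G t @[t --> a] --> u by rewrite -Ga; exact: is_diff_continuous dG.
    exact: (cG _ Ff).
  by apply: filterS2 Gg => t /= <- ->.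
have LZ := is_diff_scale dF.
rewrite -Ga in dF; apply: is_diff_eq; apply/funext => h /=.
exact: LZ.
Qed.

Lemma continuous_annulus_diffable f : (forall x, exists L, is_annulus_diff f x L) ->
  continuous (fun u => f (annulus_proj u)).
Proof.
move=> df u; have [L fL] := df (annulus_proj u).
have [w wu] := annulus_projK (f (annulus_proj u)).
have [F [Fu Ff dF]] := annulus_diff_local_lift fL wu.
have cF : annulus_proj (F v) @[v --> u] --> f (annulus_proj u).
  rewrite -wu -Fu; apply: continuous_comp; first exact: is_diff_continuous dF.
  exact: continuous_annulus_proj.
apply: cvg_trans cF; apply: near_eq_cvg.
by apply: filterS Ff => v /= ->.
Qed.

End LocalLifts.

(** * Chords and their angles *)

Section Secants.
Context {R : realType}.

Definition clamp01 (x : R) : R := Num.max 0 (Num.min x 1).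

Lemma clamp01_itv x : 0 <= clamp01 x <= 1.
Proof. by rewrite /clamp01 le_max lexx ge_max ge_min lexx ler01 orbT. Qed.

Lemma clamp01_id x : 0 <= x <= 1 -> clamp01 x = x.
Proof. by rewrite /clamp01 => /andP[x0 x1]; rewrite (min_l x1) (max_r x0). Qed.

Lemma continuous_clamp01 : continuous clamp01.
Proof.
have : continuous (fun x : R => Num.max 0 (Num.min x 1)) by cont.
by [].
Qed.

(** When [V] is the derivative of [G] in the second variable, this is the difference quotient from
    height 0, extended to all nonpositive heights so as to be continuous on the whole plane. *)
Definition secant (G V : R * R -> R) (z : R * R) : R :=
  if z.2 <= 0 then V (z.1, 0) else (G z - G (z.1, 0)) / z.2.

Lemma secant_mean_value (G V : R * R -> R) z :
  (forall t h : R, is_derive h 1 (fun x => G (t, x)) (V (t, h))) ->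
  exists2 c, 0 <= c <= Num.max z.2 0 & secant G V z = V (z.1, c).
Proof.
move=> dG; rewrite /secant; case: z => t h /=; case: leP => [h0|h0].
  by exists 0; rewrite ?lexx.
have [|c] := @MVT_segment R (fun x => G (t, x)) (fun x => V (t, x)) 0 h (ltW h0)
  (fun x _ => dG t x).
  apply: continuous_subspaceT => x.
  by apply: differentiable_continuous; apply/derivable1_diffP; have [] := dG t x.
rewrite in_itv /= subr0 => c0h ->; exists c => //.
by rewrite mulfK// gt_eqF.
Qed.

(** At heights [h0 <= 0], the mean value theorem turns every nearby secant into a value of [V] at a
    height between 0 and [max z.2 0], hence at a point close to [(t0, 0)]. *)
Lemma continuous_secant (G V : R * R -> R) : continuous G -> continuous V ->
  (forall t h : R, is_derive h 1 (fun x => G (t, x)) (V (t, h))) ->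
  continuous (secant G V).
Proof.
move=> cG cV dG [t0 h0]; have [h00|h00] := leP h0 0; last first.
  have near0 : \forall z \near (t0, h0), 0 < z.2 :> R.
    have c2 : z.2 @[z --> (t0, h0)] --> h0 by exact: cvg_snd.
    by have /cvgr_gt := c2; apply.
  have quotC : (G z - G (z.1, 0)) / z.2 @[z --> (t0, h0)] --> secant G V (t0, h0).
    rewrite /secant /= leNgt h00 /=; apply: cvgM.
      have : continuous (fun z : R * R => G z - G (z.1, 0)).
        apply: continuous_funB => //; apply: (continuous_fun_comp _ cG); cont.
      by apply.
    by apply: cvgV; [rewrite gt_eqF|exact: cvg_snd].
  apply: cvg_trans quotC; apply: near_eq_cvg.
  by apply: filterS near0 => z z0; rewrite /secant leNgt z0.
rewrite /continuous_at.
have -> : secant G V (t0, h0) = V (t0, 0) by rewrite /secant h00.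
apply/cvgrPdist_lt => e e0.
have := cV (t0, 0) => /cvgrPdist_lt /(_ e e0).
move=> /nbhs_ballP[d /= d0 dV].
have : \forall z \near (t0, h0), ball t0 d z.1 /\ z.2 < d.
  near=> z; split; near: z.
    have c1 : z.1 @[z --> (t0, h0)] --> t0 by exact: cvg_fst.
    by apply: c1; exact: nbhsx_ballx.
  have c2 : z.2 @[z --> (t0, h0)] --> h0 by exact: cvg_snd.
  by have /cvgr_lt := c2; apply; exact: le_lt_trans d0.
apply: filterS => z [z1 z2].
have [c /andP[c0 cz] ->] := secant_mean_value z dG.
apply: dV; split => //=.
rewrite /ball /= sub0r normrN ger0_norm//; apply: le_lt_trans cz _.
by rewrite gt_max z2.
Unshelve. all: by end_near. Qed.

(** Formed coordinate by coordinate, because the mean value theorem concerns scalar functions. *)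
Definition plane_secant (G V : R * R -> plane R) (z : R * R) : plane R :=
  (secant (fun x => (G x).1) (fun x => (V x).1) z,
   secant (fun x => (G x).2) (fun x => (V x).2) z).

Lemma plane_secant_le0 G V t h : h <= 0 -> plane_secant G V (t, h) = V (t, 0).
Proof. by move=> h0; rewrite /plane_secant /secant /= h0; case: (V _). Qed.

Lemma plane_secant_gt0 G V t h : 0 < h ->
  plane_secant G V (t, h) = h^-1 *: (G (t, h) - G (t, 0)).
Proof.
move=> h0; rewrite /plane_secant /secant /= leNgt h0 /=.
by apply/plane_eqP; split; rewrite /= mulrC.
Qed.

Lemma is_diff_fst_snd (F : R -> plane R) (a : R) (v : plane R) :
  is_diff a F (fun h => h *: v) ->
  is_derive a 1 (fun t => (F t).1) v.1 /\ is_derive a 1 (fun t => (F t).2) v.2.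
Proof.
move=> dF.
have der (p : {linear plane R -> R^o}) : continuous p -> is_derive a 1 (p \o F) (p v).
  move=> cp.
  have dp : is_diff (F a) p p.
    by apply: DiffDef; [exact: linear_differentiable|exact: diff_lin].
  have dpF := is_diff_comp dF dp.
  have Gd : derivable (p \o F : R -> R^o) a 1 by apply/derivable1_diffP.
  apply: DeriveDef => //.
  have := deriv1E Gd; rewrite diff_val derive1E => /(congr1 (fun h => h 1)).
  by rewrite /= !scale1r => ->.
split.
  by apply: (der fst); exact: continuous_fun_fst continuous_fun_id.
by apply: (der snd); exact: continuous_fun_snd continuous_fun_id.
Qed.

Lemma continuous_plane_secant (G V : R * R -> plane R) :
  continuous G -> continuous V ->
  (forall t h, is_diff h (fun x => G (t, x)) (fun k => k *: V (t, h))) ->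
  continuous (plane_secant G V).
Proof.
move=> cG cV dG; apply: continuous_fun_pair.
  apply: continuous_secant; [by cont|by cont|].
  by move=> t h; have [] := is_diff_fst_snd (dG t h).
apply: continuous_secant; [by cont|by cont|].
by move=> t h; have [] := is_diff_fst_snd (dG t h).
Qed.

(** An angle lift over the whole square has zero total variation around the boundary, and on each
    side it varies as the given lift does. The side [h = 1] contributes nothing, its angle being the
    constant [kappa]. *)
Lemma rectangle_variation (U : R * R -> plane R) (w0 w1 v : R -> R) kappa :
  continuous U ->
  (forall t h, 0 <= t <= 1 -> 0 <= h <= 1 -> U (t, h) != 0) ->
  continuous w0 -> continuous w1 -> continuous v ->
  (forall h, 0 <= h <= 1 -> along (w0 h) (U (0, h))) ->
  (forall h, 0 <= h <= 1 -> along (w1 h) (U (1, h))) ->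
  (forall t, 0 <= t <= 1 -> along (v t) (U (t, 0))) ->
  (forall t, 0 <= t <= 1 -> along kappa (U (t, 1))) ->
  w0 1 = w1 1 -> v 1 - v 0 = w1 0 - w0 0.
Proof.
move=> cU U0 cw0 cw1 cv Uw0 Uw1 Uv Uk w01.
pose cl (z : R * R) := (clamp01 z.1, clamp01 z.2).
have ccl : continuous cl.
  by apply: continuous_fun_pair; apply: continuous_fun_comp continuous_clamp01; cont.
have [a ca aU] := @global_lift R (fun z => U (cl z)) (continuous_fun_comp ccl cU)
  (fun z => U0 _ _ (clamp01_itv z.1) (clamp01_itv z.2)).
have aU' t h : 0 <= t <= 1 -> 0 <= h <= 1 -> along (a (t, h)) (U (t, h)).
  by move=> tI hI; have := aU (t, h); rewrite /cl /= !clamp01_id.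
have I0 : 0 <= (0 : R) <= 1 by rewrite lexx ler01.
have I1 : 0 <= (1 : R) <= 1 by rewrite lexx ler01.
have ca1 h : continuous (fun t => a (t, h)).
  apply: continuous_fun_comp ca; exact: continuous_pairl.
have ca2 t : continuous (fun h => a (t, h)).
  apply: continuous_fun_comp ca; exact: continuous_pairr.
have e1 := lift_variation_uniq cv (ca1 0) Uv (fun t tI => aU' t 0 tI I0).
have e2 := lift_variation_uniq cw0 (ca2 0) Uw0 (fun h hI => aU' 0 h I0 hI).
have e3 := lift_variation_uniq cw1 (ca2 1) Uw1 (fun h hI => aU' 1 h I1 hI).
have e4 := lift_variation_uniq (@continuous_fun_cst _ _ kappa) (ca1 1) Uk
  (fun t tI => aU' t 1 tI I1).
by move: e1 e2 e3 e4 w01; lra.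
Qed.

(** The image under [c] of a small closed interval around [h0] is compact, so it can serve as a test
    set for the compact-open topology; this makes evaluation along [c] jointly continuous. *)
Lemma continuous_compact_open_eval {Y : topologicalType}
    (J : R -> {compact-open, annulus R -> Y}) (c : R -> annulus R) :
  {within `[0, 1], continuous J} -> continuous c ->
  (forall t, 0 <= t <= 1 -> continuous (fun h => J t (c h))) ->
  continuous (fun z : R * R => J (clamp01 z.1) (c z.2)).
Proof.
move=> cJ cc cJc [t0 h0] /= W; rewrite nbhsE /= => -[B [oB Bz] BW].
have tI := clamp01_itv t0.
have : \forall h \near h0, B (J (clamp01 t0) (c h)).
  by apply: (cJc _ tI h0); exact: open_nbhs_nbhs.
move=> /nbhs_ballP[d /= d0 dB].
pose K : set R := `[h0 - d / 2, h0 + d / 2]%classic.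
have cK : compact (c @` K).
  by apply: continuous_compact; [exact: continuous_subspaceT|exact: segment_compact].
have JKB : J (clamp01 t0) @` (c @` K) `<=` B.
  move=> _ [_ [h hK <-] <-]; apply: dB.
  move: hK; rewrite /K /= in_itv /= /ball /= => /andP[? ?].
  by rewrite ltr_norml; apply/andP; split; lra.
have /subspace_continuousP := cJ => /(_ (clamp01 t0)).
rewrite /= in_itv /= => /(_ tI) /compact_open_cvgP => /(_ _ _ cK oB JKB) JB.
have nt : \forall t \near t0, J (clamp01 t) @` (c @` K) `<=` B.
  have JB' : \forall t \near t0, `[0, 1]%classic (clamp01 t) ->
      J (clamp01 t) @` (c @` K) `<=` B by exact: (@continuous_clamp01 t0 _ JB).
  by apply: filterS JB' => t /=; apply; rewrite /= in_itv /= clamp01_itv.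
have nh : \forall h \near h0, K h.
  apply/nbhs_ballP; exists (d / 2) => /=; first by rewrite divr_gt0.
  move=> h; rewrite /ball /= /K /= in_itv /= ltr_norml => /andP[? ?].
  by apply/andP; split; lra.
have n1 : \forall z \near (t0, h0), J (clamp01 z.1) @` (c @` K) `<=` B.
  have c1 : z.1 @[z --> (t0, h0)] --> t0 by exact: cvg_fst.
  exact: (c1 _ nt).
have n2 : \forall z \near (t0, h0), K z.2.
  have c2 : z.2 @[z --> (t0, h0)] --> h0 by exact: cvg_snd.
  exact: (c2 _ nh).
have n12 : \forall z \near (t0, h0), W (J (clamp01 z.1) (c z.2)).
  apply: filterS2 n1 n2 => z zB zK; apply: BW; apply: zB.
  by exists (c z.2) => //; exists z.2.
exact: n12.
Qed.

(** By induction on [M]: the path stopped at time [M + 1] is the path stopped at time [M] plus an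
    increment that vanishes for [t <= M], so gluing reduces to a sum of continuous functions. *)
Lemma continuous_glue (U : R -> plane R) :
  (forall n : nat, continuous (fun t => U (n%:R + clamp01 t))) ->
  continuous (fun t : R => U (Num.max t 0)).
Proof.
move=> cU.
have cUM (M : nat) : continuous (fun t : R => U (Num.max (Num.min t M%:R) 0)).
  elim: M => [|M IH].
    rewrite (_ : (fun t => _) = fun=> U 0); first by cont.
    apply/funext => t; rewrite max_r// ge_min lexx orbT//.
  have -> : (fun t : R => U (Num.max (Num.min t M.+1%:R) 0)) =
     (fun t : R => U (Num.max (Num.min t M%:R) 0)
        + (U (M%:R + clamp01 (t - M%:R)) - U M%:R)).
    apply/funext => t; have M0 : 0 <= M%:R :> R by [].
    rewrite -[M.+1%:R]natr1 /clamp01.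
    have [tM|Mt] := leP t M%:R.
      rewrite [Num.min t (_ + 1)]min_l; last by lra.
      rewrite [Num.min (t - _) _]min_l; last by lra.
      rewrite [Num.max 0 _]max_l; last by lra.
      by rewrite addr0 subrr addr0.
    rewrite [Num.max M%:R 0]max_l// [RHS]addrC subrK.
    congr U; have [tM1|M1t] := leP t (M%:R + 1).
      rewrite [Num.max t 0]max_l; last by lra.
      rewrite [Num.min (t - _) _]min_l; last by lra.
      rewrite [Num.max 0 _]max_r; last by lra.
      by rewrite [RHS]addrC subrK.
    rewrite [Num.min (t - _) _]min_r; last by lra.
    rewrite [Num.max 0 _]max_r//.
    by rewrite max_l//; lra.
  have cM : continuous (fun t : R => U (M%:R + clamp01 (t - M%:R))).
    by apply: (continuous_fun_comp _ (cU M)); cont.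
  move=> t; apply: cvgD; first exact: IH.
  by apply: cvgB; [exact: cM|exact: cvg_cst].
move=> t; pose M := (Num.truncn (Num.max t 0)).+1.
have tM : t < M%:R by apply: le_lt_trans (truncnS_gt _); rewrite le_max lexx.
have near1 : \forall s \near t, s < M%:R by exact: lt_nbhsl.
have := cUM M t; rewrite /continuous_at (min_l (ltW tM)); apply: cvg_trans.
apply: near_eq_cvg; apply: filterS near1 => s sM.
by rewrite (min_l (ltW sM)).
Qed.

Lemma continuous_max0 {Y : topologicalType} (v : R -> Y) :
  {within `[0, +oo[, continuous v} -> continuous (fun t : R => v (Num.max t 0)).
Proof.
move=> cv t; have /subspace_continuousP := cv => /(_ (Num.max t 0)).
have m0 s : `[0, +oo[%classic (Num.max s 0 : R).
  by rewrite /= in_itv /= andbT le_max lexx orbT.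
move=> /(_ (m0 t)) cvt W /cvt Wn.
have cm : continuous (fun s : R => Num.max s 0) by cont.
have Wn' : \forall s \near t, `[0, +oo[%classic (Num.max s 0 : R) -> W (v (Num.max s 0)).
  exact: (cm t _ Wn).
by apply: filterS Wn' => s; apply; exact: m0.
Qed.

End Secants.

(** * Angles continued along chords *)

Section Chords.
Context {R : realType}.
Implicit Types (H W : R -> plane R) (a b h k t x y kappa : R).

Definition chord H W a h : plane R :=
  if h <= 0 then W a else h^-1 *: (H (a + h) - H a).

Lemma continuous_chord (H W : R -> R -> plane R) (a : R -> R) :
  continuous (fun z : R * R => H z.1 (a z.1 + z.2)) ->
  continuous (fun z : R * R => W z.1 (a z.1 + z.2)) ->
  (forall t h, is_diff h (fun x => H t (a t + x)) (fun r : R => r *: W t (a t + h))) ->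
  continuous (fun z : R * R => chord (H z.1) (W z.1) (a z.1) z.2).
Proof.
move=> cH cW dH; have := continuous_plane_secant cH cW dH.
rewrite (_ : plane_secant _ _ = fun z => chord (H z.1) (W z.1) (a z.1) z.2)//.
apply/funext => -[t h].
have [h0|h0] := leP h 0; first by rewrite plane_secant_le0// /chord /= h0 addr0.
by rewrite plane_secant_gt0// /chord /= leNgt h0 addr0.
Qed.

(* [x] is the angle of the tangent vector [W a], lifted to the reals by
   continuation along the chords from [a] to [a + h], [h] going from 1 down to
   0, of the angle [kappa] of the vector [H (a + 1) - H a]. *)
Definition end_angle H W kappa a x := exists w : R -> R,
  [/\ continuous w, forall h, 0 <= h <= 1 -> along (w h) (chord H W a h),
      w 1 = kappa & w 0 = x].

Lemma end_angle_exists H W kappa a :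
  continuous (fun h => chord H W a (clamp01 h)) ->
  (forall h, 0 <= h <= 1 -> chord H W a h != 0) ->
  along kappa (chord H W a 1) -> exists x, end_angle H W kappa a x.
Proof.
move=> cc c0 kc.
have cc' : continuous (fun z : R * R => chord H W a (clamp01 z.2)).
  by apply: (continuous_fun_comp _ cc); cont.
have [b cb bc] := @global_lift R _ cc' (fun z => c0 _ (clamp01_itv z.2)).
have I1 : 0 <= (1 : R) <= 1 by rewrite lexx ler01.
(* The lift is shifted by [b (0, 1) - kappa], an integer since both terms are angles of the same
   chord, to take the value [kappa] at [h = 1]. *)
exists (b (0, 0) - (b (0, 1) - kappa)), (fun h => b (0, h) - (b (0, 1) - kappa)).
split => //; last by rewrite subKr.
  apply: continuous_funB; last exact: continuous_fun_cst.
  apply: continuous_fun_comp cb; exact: continuous_pairr.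
move=> h hI; have bh := bc (0, h); rewrite /= clamp01_id// in bh.
apply/(along_int _ bh); rewrite subKr.
by have b1 := bc (0, 1); rewrite /= clamp01_id// in b1; apply/(along_int _ b1).
Qed.

Lemma end_angle_along H W kappa a x : end_angle H W kappa a x -> along x (W a).
Proof.
move=> [w [_ wc _ <-]]; have I0 : 0 <= (0 : R) <= 1 by rewrite lexx ler01.
by have := wc 0 I0; rewrite /chord lexx.
Qed.

Lemma end_angle_eq H W H' W' kappa a a' x :
  (forall h, 0 <= h <= 1 -> chord H W a h = chord H' W' a' h) ->
  end_angle H W kappa a x -> end_angle H' W' kappa a' x.
Proof.
move=> e [w [cw wc w1 w0]]; exists w; split => // h hI.
by rewrite -e//; exact: wc.
Qed.

Lemma end_angle_translate H W H' W' kappa a a' (c : plane R) x :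
  (forall h, H (a + h) = H' (a' + h) + c) -> W a = W' a' ->
  end_angle H W kappa a x -> end_angle H' W' kappa a' x.
Proof.
move=> e eW; apply: end_angle_eq => h _; rewrite /chord eW.
have := e 0; rewrite !addr0 => ->; rewrite e.
by case: ifP => // _; congr (_ *: _); rewrite opprD addrACA subrr addr0.
Qed.

(* The chords of [H \o psi] and [H] are positively proportional, so lifting the
   angle along chords commutes with reparametrization; no derivative of [psi]
   is involved. *)
Lemma end_angle_reparametrize H W H' W' kappa a a' x y (psi : R -> R) :
  continuous psi -> psi 0 = 0 -> psi 1 = 1 ->
  (forall h, 0 < h <= 1 -> 0 < psi h <= 1) ->
  (forall h, 0 < h <= 1 -> H (a + h) - H a = H' (a' + psi h) - H' a') ->
  end_angle H W kappa a x -> end_angle H' W' kappa a' y -> x = y.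
Proof.
move=> cpsi psi0 psi1 psiI Hpsi [w [cw wc w1 <-]] [w' [cw' wc' w'1 <-]].
(* The difference is known to be an integer for [h > 0] only: at [h = 0] the chords become [W a] and
   [W' a'], which no hypothesis relates. Continuity settles that end. *)
suff : w 0 - w' (psi 0) = w 1 - w' (psi 1).
  by rewrite psi0 psi1 w1 w'1 subrr => /eqP; rewrite subr_eq0 => /eqP.
apply: (@int_valued_endpoints _ (fun h => w h - w' (psi h))).
  apply: continuous_subspaceT; apply: continuous_funB => //.
  exact: continuous_fun_comp cpsi cw'.
move=> h hI; have /andP[h0 h1] := hI.
have := psiI h hI; set q := psi h => /andP[q0 q1].
have wh : along (w h) (chord H W a h) by apply: wc; rewrite (ltW h0).
have wq : along (w' q) (chord H' W' a' q) by apply: wc'; rewrite (ltW q0).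
apply/(along_int _ wh).
have -> : chord H W a h = (q / h) *: chord H' W' a' q.
  rewrite /chord leNgt h0 leNgt q0 /= Hpsi// scalerA mulrAC divff ?gt_eqF//.
  by rewrite mul1r.
by apply: alongZ => //; rewrite divr_gt0.
Qed.

End Chords.

(** * Plane lifts of the curve and their period *)

Section Curve.
Context {R : realType}.
Variable gamma : circle R -> annulus R.
Hypothesis hgamma : C1_essential_curve gamma.

Let W (h : R) : plane R := velocity gamma (circle_proj h).

Lemma is_velocityW s : is_velocity gamma s (velocity gamma s).
Proof. by have [_ /(_ s)[w gw] _ _] := hgamma; rewrite (velocityP gw). Qed.

Lemma continuous_curve : continuous (fun h => gamma (circle_proj h)).
Proof.
have [[[cg _] _] _ _ _] := hgamma.
exact: continuous_fun_comp continuous_circle_proj cg.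
Qed.

Lemma continuous_velocity : continuous W.
Proof.
have [_ _ cv _] := hgamma.
exact: continuous_fun_comp continuous_circle_proj cv.
Qed.

Lemma velocity_neq0 h : W h != 0.
Proof. by have [_ _ _ v0] := hgamma; exact: v0. Qed.

Lemma curve_inj : injective gamma.
Proof. by have [[[_ [g [gK _]]] _] _ _ _] := hgamma; exact: can_inj gK. Qed.

Lemma velocity_lift_eq h n : n \is a Num.int -> W (h + n) = W h.
Proof. by move=> ni; rewrite /W circle_projD. Qed.

Lemma lift_period (c : circle R -> annulus R) (H : R -> plane R) :
  continuous H -> (forall h, annulus_proj (H h) = c (circle_proj h)) ->
  exists2 k, k \is a Num.int & forall h, H (h + 1) = H h + (k, 0).
Proof.
move=> cH Hc.
have step h : annulus_proj (H (h + 1)) = annulus_proj (H h) by rewrite !Hc circle_projD.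
pose d h := (H (h + 1)).1 - (H h).1.
have di h : d h \is a Num.int by have /annulus_projP[] := step h.
have cd : continuous d.
  have cH1 : continuous (fun h : R => H (h + 1)) by apply: (continuous_fun_comp _ cH); cont.
  by apply: continuous_funB; cont.
exists (d 0) => // h; rewrite (int_valued_constant cd di 0 h).
apply/plane_eqP; split; first by rewrite /d /= subrKC.
by rewrite /= addr0; have /annulus_projP[] := step h.
Qed.

Lemma lift_periodz (H : R -> plane R) k :
  (forall h, H (h + 1) = H h + (k, 0)) ->
  forall h n, n \is a Num.int -> H (h + n) = H h + (n * k, 0).
Proof.
move=> Hk.
have nat_case (m : nat) h : H (h + m%:R) = H h + (m%:R * k, 0).
  elim: m h => [|m IH] h.
    by rewrite addr0 mul0r; apply/plane_eqP; rewrite /= !addr0.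
  rewrite -[m.+1%:R]natr1 addrA Hk IH; apply/plane_eqP; split => /=; first by ring.
  by rewrite !addr0.
move=> h n /intrP[[m|m] ->]; first exact: nat_case.
have := nat_case m.+1 (h + (Negz m)%:~R).
rewrite NegzE mulrNz -[_%:~R]/(m.+1%:R) subrK => ->.
by apply/plane_eqP; split => /=; [ring|rewrite !addr0].
Qed.

(** The period is nonzero because a lift of period 0 would descend to the circle and shrink linearly
    to the origin of the plane; the projection of this contraction would make [gamma]
    null-homotopic. *)
Lemma curve_lift : exists H : R -> plane R, [/\ continuous H,
    forall h, annulus_proj (H h) = gamma (circle_proj h) &
    exists k, [/\ k \is a Num.int, k != 0 & forall h, H (h + 1) = H h + (k, 0)]].
Proof.
have cc : continuous (fun z : R * R => gamma (circle_proj z.1)).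
  by apply: (continuous_fun_comp _ continuous_curve); cont.
have [G cG Gc] := annulus_lift cc.
pose H h := G (h, 0).
have cH : continuous H.
  by apply: continuous_fun_comp cG; exact: continuous_pairl.
have Hc h : annulus_proj (H h) = gamma (circle_proj h) by rewrite /H Gc.
exists H; split => //.
have [k ki Hk] := lift_period cH Hc; exists k; split => //; apply/eqP => k0.
have [[_ not_null] _ _ _] := hgamma; apply: not_null.
pose E (s : circle R) : plane R := H (repr s).
have EP h : E (circle_proj h) = H h.
  rewrite /E -[repr _](subrKC h).
  rewrite (lift_periodz Hk) ?k0 ?mulr0; last first.
    by apply/circle_projP; rewrite /circle_proj reprK.
  by apply/plane_eqP; rewrite /= !addr0.
have cE : continuous E.
  apply/quotient_continuous; rewrite (_ : _ \o _ = H) //.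
  by apply/funext => h; exact: EP.
exists (fun z => annulus_proj ((1 - z.2) *: E z.1)), (annulus_proj 0); split.
- apply: continuous_subspaceT; apply: (continuous_fun_comp _ continuous_annulus_proj).
  apply: continuous_funZ; first by cont.
  by apply: (continuous_fun_comp _ cE); cont.
- move=> s; have [h <-] := circle_projK s.
  by rewrite /= subr0 scale1r EP Hc.
- by move=> s; rewrite /= subrr scale0r.
Qed.

End Curve.

(** * The isotopy along the curve *)

Section Isotopy.
Context {R : realType}.
Variables (gamma : circle R -> annulus R) (hgamma : C1_essential_curve gamma).
Variables (H : R -> plane R) (k kappa : R).
Hypotheses (cH : continuous H)
  (Hg : forall h, annulus_proj (H h) = gamma (circle_proj h))
  (k0 : k != 0) (Hk : forall h, H (h + 1) = H h + (k, 0))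
  (along_kappa : along kappa ((k, 0) : plane R)).

Let W (h : R) : plane R := velocity gamma (circle_proj h).

Lemma same_point_int a b : gamma (circle_proj a) = gamma (circle_proj b) ->
  a - b \is a Num.int.
Proof. by move=> /(curve_inj hgamma) /circle_projP. Qed.

(** * Families of injective closed curves starting from the given one *)

Section Family.
Variables (J : R -> circle R -> annulus R) (G V : R * R -> plane R).
Hypotheses (cG : continuous G) (cV : continuous V)
  (GJ : forall z, annulus_proj (G z) = J z.1 (circle_proj z.2))
  (VJ : forall z, is_velocity (J z.1) (circle_proj z.2) (V z))
  (J_inj : forall t, injective (J t)) (V0 : forall z, V z != 0)
  (G0 : exists c, forall h, G (0, h) = H h + c).

(** The increment over one turn is an integer depending continuously on both parameters, so it keeps
    the value [k] that it has for the initial curve. *)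
Lemma family_period z : G (z.1, z.2 + 1) = G z + (k, 0).
Proof.
have step (w : R * R) : annulus_proj (G (w.1, w.2 + 1)) = annulus_proj (G w).
  by rewrite !GJ circle_projD.
pose d (w : R * R) := (G (w.1, w.2 + 1)).1 - (G w).1.
have di w : d w \is a Num.int by have /annulus_projP[] := step w.
have cd : continuous d.
  have cG1 : continuous (fun w : R * R => G (w.1, w.2 + 1)).
    by apply: (continuous_fun_comp _ cG); cont.
  by apply: continuous_funB; cont.
have [c Gc] := G0.
have dk : d z = k.
  rewrite (int_valued_constant cd di z (0, 0)) /d /= !Gc Hk /=; ring.
apply/plane_eqP; split; first by rewrite -dk /d /= subrKC.
by rewrite /= addr0; have /annulus_projP[] := step z.
Qed.

Let GG t h := G (t, h).
Let VV t h := V (t, h).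

Lemma family_is_diff t h : is_diff h (GG t) (fun r : R => r *: VV t h).
Proof.
apply: (@lift_is_diff _ (J t)).
- apply: (continuous_fun_comp _ cG); exact: continuous_pairr.
- by apply: near_all => x; rewrite /GG GJ.
- exact: (VJ (t, h)).
Qed.

Lemma family_chord1 t a : chord (GG t) (VV t) a 1 = (k, 0).
Proof.
rewrite /chord leNgt ltr01 /= invr1 scale1r /GG (family_period (t, a)).
by rewrite addrC addKr.
Qed.

(** For [0 < h < 1] injectivity of the curve separates the two endpoints; at [h = 0] the chord is
    the nonzero velocity, and at [h = 1] it is [(k, 0)]. *)
Lemma family_chord_neq0 t a h : 0 <= h <= 1 -> chord (GG t) (VV t) a h != 0.
Proof.
move=> /andP[h0 h1]; have [->|hn1] := eqVneq h 1.
  by rewrite family_chord1; exact: along_neq0 along_kappa.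
rewrite /chord; case: leP => [_|{}h0]; first exact: V0.
rewrite scaler_eq0 invr_eq0 gt_eqF//= subr_eq0; apply/eqP => e.
have : J t (circle_proj (a + h)) = J t (circle_proj a).
  by have := GJ (t, a + h); have := GJ (t, a); rewrite /= /GG in e * => <- <-; rewrite e.
move=> /(@J_inj t) /circle_projP; rewrite addrC addKr => hi.
have := norm_intr_ge1 hi (lt0r_neq0 h0).
by rewrite (gtr0_norm h0) leNgt lt_neqAle hn1 h1.
Qed.

Lemma family_chord_continuous (a b : R -> R) : continuous a -> continuous b ->
  continuous (fun z : R * R => chord (GG (b z.1)) (VV (b z.1)) (a z.1) z.2).
Proof.
move=> ca cb.
have cz : continuous (fun z : R * R => (b z.1, a z.1 + z.2)).
  apply: continuous_fun_pair; first by apply: (continuous_fun_comp _ cb); cont.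
  by apply: continuous_funD; [apply: (continuous_fun_comp _ ca)|]; cont.
have d t h : is_diff h (fun x => GG (b t) (a t + x)) (fun r : R => r *: VV (b t) (a t + h)).
  have := is_diff_shift h (0 : plane R) (family_is_diff (b t) (a t + h)).
  rewrite addrK; apply: is_diff_near; apply: near_all => x.
  by rewrite addr0 [x + a t]addrC.
pose GGb t := GG (b t); pose VVb t := VV (b t).
exact: (@continuous_chord _ GGb VVb a
  (continuous_fun_comp cz cG) (continuous_fun_comp cz cV) d).
Qed.

Lemma family_end_angle t a : exists x, end_angle (GG t) (VV t) kappa a x.
Proof.
apply: end_angle_exists.
- have cz : continuous (fun h : R => (0 : R, clamp01 h)).
    by apply: continuous_fun_pair; [cont|exact: continuous_clamp01].
  have cc := @family_chord_continuous (fun=> a) (fun=> t)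
    (@continuous_fun_cst _ _ a) (@continuous_fun_cst _ _ t).
  exact: (continuous_fun_comp cz cc).
- by move=> h; exact: family_chord_neq0.
- by rewrite family_chord1.
Qed.

(** The square has one side for the parameter [t], which may move both the base point [a t] and the
    curve [b t], and one for the chord length. It serves with a fixed curve and a moving base point,
    and with a moving curve and a fixed base point. *)
Lemma family_variation (a b v : R -> R) x y :
  continuous a -> continuous b -> continuous v ->
  end_angle (GG (b 0)) (VV (b 0)) kappa (a 0) x ->
  end_angle (GG (b 1)) (VV (b 1)) kappa (a 1) y ->
  (forall t, 0 <= t <= 1 -> along (v t) (V (b t, a t))) ->
  v 1 - v 0 = y - x.
Proof.
move=> ca cb cv [w0 [cw0 w0c w01 <-]] [w1 [cw1 w1c w11 <-]] vV.
apply: (@rectangle_variation _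
  (fun z : R * R => chord (GG (b z.1)) (VV (b z.1)) (a z.1) z.2) w0 w1 v kappa) => //.
- exact: family_chord_continuous.
- by move=> t h _; exact: family_chord_neq0.
- by move=> t tI; rewrite /chord /= lexx; exact: vV.
- by move=> t tI /=; rewrite family_chord1.
- by rewrite w01 w11.
Qed.

End Family.
(** The constant family, through which the results on families apply to [gamma] itself. *)
Let H2 (z : R * R) := H z.2.
Let W2 (z : R * R) := W z.2.

Let cH2 : continuous H2.
Proof. by apply: (continuous_fun_comp _ cH); cont. Qed.

Let cW2 : continuous W2.
Proof. by apply: (continuous_fun_comp _ (continuous_velocity hgamma)); cont. Qed.

Let H2g (z : R * R) : annulus_proj (H2 z) = gamma (circle_proj z.2).
Proof. exact: Hg. Qed.

Let W2g (z : R * R) : is_velocity gamma (circle_proj z.2) (W2 z).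
Proof. exact: is_velocityW. Qed.

Let gI (t : R) : injective gamma.
Proof. exact: curve_inj. Qed.

Let W20 z : W2 z != 0.
Proof. exact: velocity_neq0. Qed.

Let H20 : exists c, forall h, H2 (0, h) = H h + c.
Proof. by exists 0 => h; rewrite addr0. Qed.

Lemma curve_end_angle a : exists x, end_angle H W kappa a x.
Proof. exact: (@family_end_angle (fun=> gamma) H2 W2 cH2 cW2 H2g W2g gI W20 H20 0 a). Qed.

Lemma curve_variation (a v : R -> R) x y :
  continuous a -> continuous v ->
  end_angle H W kappa (a 0) x -> end_angle H W kappa (a 1) y ->
  (forall t, 0 <= t <= 1 -> along (v t) (W (a t))) -> v 1 - v 0 = y - x.
Proof.
move=> ca cv ax ay va.
exact: (@family_variation (fun=> gamma) H2 W2 cH2 cW2 H2g W2g gI W20 H20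
  a (fun=> 0) v x y ca (@continuous_fun_cst _ _ 0) cv ax ay va).
Qed.

Lemma end_angle_int a b x : a - b \is a Num.int ->
  end_angle H W kappa a x -> end_angle H W kappa b x.
Proof.
move=> ab; apply: (@end_angle_translate _ _ _ _ _ _ _ _ ((a - b) * k, 0)).
  move=> h; rewrite -(lift_periodz Hk)//; congr H; ring.
by rewrite -[a](subrKC b); exact: velocity_lift_eq.
Qed.

Lemma lifts_differ_by_constant (F1 F2 : R -> plane R) :
  continuous F1 -> continuous F2 ->
  (forall h, annulus_proj (F1 h) = annulus_proj (F2 h)) ->
  exists c, forall h, F1 h = F2 h + c.
Proof.
move=> c1 c2 F12.
pose d h := (F1 h).1 - (F2 h).1.
have di h : d h \is a Num.int by have /annulus_projP[] := F12 h.
have cd : continuous d by apply: continuous_funB; cont.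
exists (d 0, 0) => h; rewrite (int_valued_constant cd di 0 h).
have /annulus_projP[_ e2] := F12 h.
by apply/plane_eqP; split; rewrite /= ?addr0// /d subrKC.
Qed.

(** A negative value at [h] would force the value 0 between [h] and 1, and a value above 1 would
    force the value 1 between 0 and [h]; on the open unit interval [psi] takes no integer value. *)
Lemma reparametrization_range (psi : R -> R) : continuous psi ->
  psi 0 = 0 -> psi 1 = 1 ->
  (forall h, 0 < h < 1 -> psi h \isn't a Num.int) ->
  forall h, 0 < h <= 1 -> 0 < psi h <= 1.
Proof.
move=> cpsi psi0 psi1 psi_nint h /andP[h0]; rewrite le_eqVlt => /predU1P[->|h1].
  by rewrite psi1 lexx ltr01.
have cI (i : interval R) : {within [set` i], continuous psi} by exact: continuous_subspaceT.
have hn : psi h \isn't a Num.int by apply: psi_nint; rewrite h0.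
apply/andP; split; rewrite leNgt// || rewrite ltNge.
  apply/negP; rewrite le_eqVlt => /predU1P[e|neg].
    by move: hn; rewrite e int_num0.
  have [|c] := IVT (ltW h1) (cI `[h, 1]) (v := 0).
    by rewrite psi1 min_l ?max_r ?(ltW neg) ?ler01//; lra.
  rewrite in_itv /= => /andP[hc c1] pc.
  have cn1 : c < 1.
    rewrite lt_neqAle c1 andbT; apply/eqP => ce.
    by move: pc; rewrite ce psi1 => /eqP; rewrite oner_eq0.
  have := psi_nint c; rewrite (lt_le_trans h0 hc) cn1 pc => /(_ isT).
  by rewrite int_num0.
apply/negP => big.
have [|c] := IVT (ltW h0) (cI `[0, h]) (v := 1).
  by rewrite psi0 min_l ?max_r ?(ltW big) ?ler01//; lra.
rewrite in_itv /= => /andP[c0 ch] pc.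
have cn0 : 0 < c.
  rewrite lt_neqAle c0 andbT; apply/eqP => ce.
  by move: pc; rewrite -ce psi0 => /eqP; rewrite eq_sym oner_eq0.
have := psi_nint c; rewrite cn0 (le_lt_trans ch h1) pc => /(_ isT).
by rewrite int_num1.
Qed.

Variables (f : annulus R -> annulus R) (I : R -> annulus R -> annulus R).
Hypotheses (hI : isotopy_to f I) (hinv : invariant_curve f gamma).

(** Frozen outside [[0, 1]], so that the isotopy becomes a family indexed by all real times. *)
Let It t := I (clamp01 t).

Lemma isotopy_C1_diffeo t : C1_diffeo (It t).
Proof.
by have [hd _ _ _ _] := hI; apply: hd; rewrite in_itv /= clamp01_itv.
Qed.

Lemma isotopy_diff t (x : annulus R) : is_annulus_diff (It t) x (annulus_diff (It t) x).
Proof.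
by have [[/(_ x)[L fL] _] _] := isotopy_C1_diffeo t; rewrite (annulus_diffP fL).
Qed.

(** By the chain rule the differential of the inverse map is a left inverse of [L]. *)
Lemma C1_diffeo_diff_neq0 (g : annulus R -> annulus R) x L (u : plane R) :
  C1_diffeo g -> is_annulus_diff g x L ->  u != 0 -> L u != 0.
Proof.
move=> [_ [g' [[dg' _] gK _]]] gL u0.
have [M g'M] := dg' (g x).
have := is_annulus_diff_comp gL g'M.
have -> : g' \o g = id by apply/funext => z; exact: gK.
move=> /is_annulus_diff_uniq /(_ (is_annulus_diff_id x)) /(congr1 (fun h => h u)) /= ML.
apply/eqP => Lu; move: u0; rewrite -ML Lu => /eqP; apply.
by have [v [F [_ _ dF]]] := g'M; exact: is_diff_fun0 dF.
Qed.

Let V (z : R * R) := annulus_diff (It z.1) (gamma (circle_proj z.2)) (W z.2).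

Let V_neq0 z : V z != 0.
Proof.
apply: (C1_diffeo_diff_neq0 (isotopy_C1_diffeo z.1) (isotopy_diff _ _)).
exact: velocity_neq0.
Qed.

Lemma continuous_isotopy_curve :
  continuous (fun z : R * R => It z.1 (gamma (circle_proj z.2))).
Proof.
have [hd _ _ cI _] := hI.
apply: (continuous_compact_open_eval cI (continuous_curve hgamma)) => t tI.
have [[df _] _] : C1_diffeo (I t) by apply: hd; rewrite in_itv.
have := continuous_fun_comp cH (continuous_annulus_diffable df).
by under eq_fun do rewrite Hg.
Qed.

(** An isotopy gives continuity of the differentials on each fixed vector, whereas here the vector
    moves as well; decomposing it in the standard basis reduces to two fixed vectors. *)
Lemma continuous_isotopy_velocity : continuous V.
Proof.
have [hd _ _ _ cD] := hI.
pose D xi (z : R * R) := annulus_diff (It z.1) (gamma (circle_proj z.2)) xi.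
have cDxi xi : continuous (D xi).
  apply: (continuous_compact_open_eval (cD xi) (continuous_curve hgamma)) => t tI.
  have [[_ cdf] _] : C1_diffeo (I t) by apply: hd; rewrite in_itv.
  exact: continuous_fun_comp (continuous_curve hgamma) (cdf xi).
have VE : V = fun z => (W2 z).1 *: D (1, 0) z + (W2 z).2 *: D (0, 1) z.
  apply/funext => z; have [u [F [_ _ dF]]] := isotopy_diff z.1 (gamma (circle_proj z.2)).
  rewrite /V /D -(is_diff_scale dF (W2 z).2) -(is_diff_linear dF).
  congr (annulus_diff _ _ _).
  by apply/plane_eqP; split => /=; rewrite /GRing.scale /= !(mulr0, mulr1, addr0, add0r).
rewrite VE => z; apply: cvgD.
  by apply: cvgZ; [exact: (continuous_fun_fst cW2)|exact: cDxi].
by apply: cvgZ; [exact: (continuous_fun_snd cW2)|exact: cDxi].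
Qed.

(** Since [f o gamma] is a reparametrization of [gamma], the canonical angle at time 1 of the family
    [I t o gamma] is the canonical angle [y] of [gamma] at the image point. The first conclusion
    lets the argument be iterated along the orbit; the second is the variation formula for this
    family. *)
Lemma one_step a a' x y : f (gamma (circle_proj a)) = gamma (circle_proj a') ->
  end_angle H W kappa a x -> end_angle H W kappa a' y ->
  along y (annulus_diff f (gamma (circle_proj a)) (W a)) /\
  forall v : R -> R, continuous v ->
    (forall t, 0 <= t <= 1 ->
       along (v t) (annulus_diff (I t) (gamma (circle_proj a)) (W a))) ->
    v 1 - v 0 = y - x.
Proof.
move=> faa' ax a'y.
have [_ I0 I1 _ _] := hI.
have It0 : It 0 = id by rewrite /It clamp01_id// lexx ler01.
have It1 : It 1 = f by rewrite /It clamp01_id// lexx ler01.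
have [G cG GI] := annulus_lift continuous_isotopy_curve.
pose J t s := It t (gamma s).
have GJ (z : R * R) : annulus_proj (G z) = J z.1 (circle_proj z.2) by exact: GI.
have VJ z : is_velocity (J z.1) (circle_proj z.2) (V z).
  exact: (is_velocity_comp (is_velocityW hgamma _) (isotopy_diff _ _)).
have J_inj t : injective (J t).
  have [_ [g [_ gK _]]] := isotopy_C1_diffeo t.
  by move=> s s' /(can_inj gK) /(curve_inj hgamma).
have cG1 t : continuous (fun h => G (t, h)).
  apply: (continuous_fun_comp _ cG).
  exact: continuous_pairr.
have G0 : exists c, forall h, G (0, h) = H h + c.
  by apply: (lifts_differ_by_constant (cG1 0) cH) => h; rewrite GI Hg /= It0.
have period := family_period cG GJ G0.
have [[[_ [g [gK cg]]] _] _ _ _] := hgamma.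
(* By invariance, the left inverse [g] of [gamma] is also a right inverse at points of [f o gamma];
   thus [g o f o gamma] is a continuous self-map of the circle, which lifts to [phi]. *)
have fgammaK s : gamma (g (f (gamma s))) = f (gamma s).
  have : range gamma (f (gamma s)) by rewrite -hinv; exists (gamma s) => //; exists s.
  by move=> [s' _ <-]; rewrite gK.
have cf : continuous (fun h => f (gamma (circle_proj h))).
  have cz : continuous (fun h : R => (1 : R, h)).
    exact: continuous_pairr.
  by have := continuous_fun_comp cz continuous_isotopy_curve; rewrite /= It1.
have cq : continuous (fun z : R * R => g (f (gamma (circle_proj z.1)))).
  apply: (@continuous_fun_comp _ _ _ (fun z : R * R => z.1)
    (fun h => g (f (gamma (circle_proj h))))).
    by cont.
  move=> h; have /subspace_continuousP := cg.
  have rg h' : range gamma (f (gamma (circle_proj h'))).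
    by rewrite -fgammaK; exists (g (f (gamma (circle_proj h')))).
  move=> /(_ _ (rg h)) cgh N /cgh Nn.
  have Nn' : \forall h' \near h, range gamma (f (gamma (circle_proj h'))) ->
      N (g (f (gamma (circle_proj h')))).
    exact: (cf h _ Nn).
  by apply: filterS Nn' => h'; apply; exact: rg.
have [phi2 cphi2 phi2P] := circle_lift cq.
pose phi h := phi2 (h, 0).
have cphi : continuous phi.
  apply: (continuous_fun_comp _ cphi2).
  exact: continuous_pairl.
have phiP h : gamma (circle_proj (phi h)) = f (gamma (circle_proj h)).
  by rewrite /phi phi2P fgammaK.
have [c1 G1] : exists c, forall h, G (1, h) = H (phi h) + c.
  apply: (lifts_differ_by_constant (cG1 1) (continuous_fun_comp cphi cH)) => h.
  by rewrite GI Hg phiP /= It1.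
pose psi h := phi (a + h) - phi a.
have cpsi : continuous psi.
  have cah : continuous (fun h => phi (a + h)).
    apply: (continuous_fun_comp _ cphi).
    by apply: continuous_funD; [exact: continuous_fun_cst|exact: continuous_fun_id].
  by apply: continuous_funB; cont.
have psi0 : psi 0 = 0 by rewrite /psi addr0 subrr.
(* Over one turn [G (1, _)] advances by [(k, 0)], the period kept since time 0, while [H o phi]
   advances by [(psi 1 * k, 0)]. As [k] is nonzero, [phi] has degree 1; in particular [f] preserves
   the direction of travel along [gamma]. *)
have psi1 : psi 1 = 1.
  have di : psi 1 \is a Num.int.
    by apply: same_point_int; rewrite !phiP circle_projD.
  have := period (1, a); rewrite /= !G1 -(subrKC (phi a) (phi (a + 1))) -/(psi 1).
  rewrite (lift_periodz Hk _ di) => /plane_eqP[/= e _].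
  by apply: (mulIf k0); rewrite mul1r; lra.
have psiI := reparametrization_range cpsi psi0 psi1 _.
(* An integer value of [psi] inside the unit interval would make the injective curve [f o gamma]
   return too early. *)
have {}psiI h : 0 < h <= 1 -> 0 < psi h <= 1.
  apply: psiI => {}h /andP[h0 h1]; apply/negP => hi.
  have e : f (gamma (circle_proj (a + h))) = f (gamma (circle_proj a)).
    by rewrite -!phiP; congr gamma; apply/circle_projP.
  move: e; rewrite -It1 => /(J_inj 1) /circle_projP; rewrite addrC addKr => hi'.
  by have := norm_intr_ge1 hi' (lt0r_neq0 h0); rewrite (gtr0_norm h0) leNgt h1.
have [x1 ax1] := family_end_angle cG continuous_isotopy_velocity GJ VJ J_inj V_neq0 G0 1 a.
have a'phi : end_angle H W kappa (phi a) y.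
  by apply: end_angle_int a'y; apply: same_point_int; rewrite phiP faa'.
have x1y : x1 = y.
  apply: (end_angle_reparametrize cpsi psi0 psi1 psiI _ ax1 a'phi) => h _.
  by rewrite !G1 /psi subrKC opprD addrACA subrr addr0.
have [c0 G0c] := G0.
have ax0 : end_angle (fun h => G (0, h)) (fun h => V (0, h)) kappa a x.
  apply: (@end_angle_translate _ _ _ _ _ _ _ _ (- c0)) ax.
    by move=> h; rewrite G0c addrK.
  by rewrite /V /= It0 (annulus_diffP (is_annulus_diff_id _)).
split; first by have := end_angle_along ax1; rewrite x1y /V /= It1.
move=> v cv va; rewrite -x1y.
apply: (family_variation cG continuous_isotopy_velocity GJ VJ J_inj V_neq0 G0
  (a := fun=> a) (b := fun t => t) _ _ cv ax0 ax1).
- exact: continuous_fun_cst.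
- exact: continuous_fun_id.
- by move=> t tI; rewrite /V /= /It clamp01_id//; exact: va.
Qed.

End Isotopy.

(** * Torsion and angle variation *)

Section Torsion.
Context {R : realType}.
Variables (f : annulus R -> annulus R) (gamma : circle R -> annulus R).
Hypotheses (f_isotopic : isotopic_to_id f) (hgamma : C1_essential_curve gamma)
  (hinv : invariant_curve f gamma).
Variables (H : R -> plane R) (k kappa : R).
Hypotheses (cH : continuous H)
  (Hg : forall h, annulus_proj (H h) = gamma (circle_proj h))
  (k0 : k != 0) (Hk : forall h, H (h + 1) = H h + (k, 0))
  (along_kappa : along kappa ((k, 0) : plane R)).

Let W (h : R) : plane R := velocity gamma (circle_proj h).

Lemma along_proportional a (u v : plane R) : along a u -> along a v ->
  exists2 r, 0 < r & u = r *: v.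
Proof.
move=> [r r0 ->] [q q0 ->]; exists (r / q); first by rewrite divr_gt0.
by rewrite scalerA divfK// gt_eqF.
Qed.

Variables (s : circle R) (a X : nat -> R).
Hypotheses (aP : forall n, gamma (circle_proj (a n)) = iter n f (gamma s))
  (XP : forall n, end_angle H W kappa (a n) (X n)).

Lemma orbit_step n : f (gamma (circle_proj (a n))) = gamma (circle_proj (a n.+1)).
Proof. by rewrite !aP. Qed.

(** The factor is positive because, by [one_step], the image under the differential of [f] of the
    tangent vector at [a n] has the same angle [X n.+1] as the tangent vector at [a n.+1]. *)
Lemma iter_diff n : exists2 L, is_annulus_diff (iter n f) (gamma s) L &
  exists2 r, 0 < r & L (velocity gamma s) = r *: W (a n).
Proof.
elim: n => [|n [L fL [r r0 Lr]]].
  exists id; first exact: is_annulus_diff_id.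
  exists 1 => //; rewrite scale1r /W; congr velocity.
  by apply: (curve_inj hgamma); rewrite aP.
have [I hI] := f_isotopic.
have [Xf _] := one_step hgamma cH Hg k0 Hk along_kappa hI hinv
  (orbit_step n) (XP n) (XP n.+1).
have [q q0 fq] := along_proportional Xf (end_angle_along (XP n.+1)).
have [M fM] : exists M, is_annulus_diff f (iter n f (gamma s)) M.
  have [hd _ I1 _ _] := hI.
  have [[df _] _] : C1_diffeo (I 1) by apply: hd; rewrite in_itv /= lexx ler01.
  by rewrite -I1; exact: df.
exists (M \o L); first exact: is_annulus_diff_comp fL fM.
exists (r * q); first by rewrite mulr_gt0.
move: fq; rewrite aP (annulus_diffP fM) => fq.
rewrite /= Lr -scalerA -fq.
have [u [F [_ _ dF]]] := fM.
exact: is_diff_scale dF _ _.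
Qed.

Lemma extended_isotopyE I n t : isotopy_to f I -> 0 <= t <= 1 ->
  extended_isotopy I (n%:R + t) = I t \o iter n f.
Proof.
move=> [_ I0 I1 _ _] /andP[t0]; rewrite /extended_isotopy I1 le_eqVlt.
move=> /predU1P[->|t1].
  (* At [t = 1] the integer part is already [n + 1]; the two descriptions agree because [I 0 = id]
     and [I 1 = f]. *)
  by rewrite natr1 natrK subrr I0 I1.
suff -> : Num.truncn (n%:R + t) = n by rewrite addrC addKr.
by apply: truncn_def; rewrite lerDl t0 -natr1 ltrD2l.
Qed.

(** The factor [r] comes from the differential of [iter n f] alone and is the same for all [t] in
    the unit interval. *)
Lemma extended_diff I n : isotopy_to f I -> exists2 r, 0 < r &
  forall t, 0 <= t <= 1 ->
    annulus_diff (extended_isotopy I (n%:R + t)) (gamma s) (velocity gamma s)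
    = r *: annulus_diff (I t) (gamma (circle_proj (a n))) (W (a n)).
Proof.
move=> hI; have [L fL [r r0 Lr]] := iter_diff n; exists r => // t tI.
rewrite extended_isotopyE//.
have := isotopy_diff hI t (iter n f (gamma s)); rewrite clamp01_id// => dI.
rewrite (annulus_diffP (is_annulus_diff_comp fL dI)) /= Lr aP.
have [u [F [_ _ dF]]] := dI.
exact: is_diff_scale dF _ _.
Qed.

Lemma isotopy_velocity_neq0 I t b : isotopy_to f I -> 0 <= t <= 1 ->
  annulus_diff (I t) (gamma (circle_proj b)) (W b) != 0.
Proof.
move=> hI tI; have := isotopy_diff hI t (gamma (circle_proj b)).
rewrite clamp01_id// => dI.
have := isotopy_C1_diffeo hI t; rewrite clamp01_id// => hd.
exact: C1_diffeo_diff_neq0 hd dI (velocity_neq0 hgamma b).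
Qed.

Lemma extended_diff_neq0 I t : isotopy_to f I -> 0 <= t ->
  annulus_diff (extended_isotopy I t) (gamma s) (velocity gamma s) != 0.
Proof.
move=> hI t0; pose n := Num.truncn t.
have tI : 0 <= t - n%:R <= 1.
  by have := truncn_itv t0; rewrite -natr1 -/n => /andP[? ?]; apply/andP; split; lra.
have [r r0 /(_ _ tI)] := extended_diff n hI.
rewrite subrKC => ->; rewrite scaler_eq0 gt_eqF//=.
exact: isotopy_velocity_neq0.
Qed.

(** On [[n, n + 1]] the lift follows, up to a positive factor, the isotopy acting on the tangent
    vector at [a n], so [one_step] gives the increment. The result involves neither the isotopy nor
    the lift, as a well defined torsion requires. *)
Lemma angle_lift_variation I v n : isotopy_to f I ->
  angle_lift I (gamma s) (velocity gamma s) v -> v n%:R - v 0 = X n - X 0.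
Proof.
move=> hI [cv vP]; elim: n => [|n IH]; first by rewrite !subrr.
suff : v n.+1%:R - v n%:R = X n.+1 - X n by lra.
have [_ h] := one_step hgamma cH Hg k0 Hk along_kappa hI hinv
  (orbit_step n) (XP n) (XP n.+1).
have max_n t : 0 <= t -> Num.max (n%:R + t) 0 = n%:R + t.
  by move=> t0; rewrite max_l// addr_ge0.
have := h (fun t => v (Num.max (n%:R + t) 0)) _ _.
rewrite !max_n// addr0 natr1; apply.
  apply: (continuous_fun_comp _ (continuous_max0 cv)).
  by apply: continuous_funD; [exact: continuous_fun_cst|exact: continuous_fun_id].
move=> t tI; have /andP[t0 t1] := tI; rewrite max_n//.
have nt0 : 0 <= n%:R + t by rewrite addr_ge0.
have [r r0 /(_ _ tI) dE] := extended_diff n hI.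
have /thetaP := esym (vP _ nt0); rewrite extended_diff_neq0// => /(_ isT).
rewrite dE => al; have := alongZ (r := r^-1) _ al.
by rewrite invr_gt0 scalerA mulVf ?gt_eqF// scale1r; apply.
Qed.

(** [torsion] selects from a set and returns 0 if the set is empty, so a lift must be exhibited: the
    velocities on successive unit intervals glue to a continuous nonzero path. *)
Lemma angle_lift_exists I : isotopy_to f I ->
  exists v, angle_lift I (gamma s) (velocity gamma s) v.
Proof.
move=> hI.
pose U t := annulus_diff (extended_isotopy I t) (gamma s) (velocity gamma s).
have cU : continuous (fun t : R => U (Num.max t 0)).
  apply: continuous_glue => n; have [r r0 rP] := extended_diff n hI.
  have cz : continuous (fun t : R => (t, a n)).
    exact: continuous_pairl.
  have cI := continuous_fun_comp cz (continuous_isotopy_velocity hgamma hI).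
  have -> : (fun t => U (n%:R + clamp01 t)) =
      fun t => r *: annulus_diff (I (clamp01 t)) (gamma (circle_proj (a n))) (W (a n)).
    by apply/funext => t; rewrite /U rP// clamp01_itv.
  by move=> t; apply: cvgZ; [exact: cvg_cst|exact: cI].
have m0 t : 0 <= Num.max t (0 : R) by rewrite le_max lexx orbT.
have [b cb bU] := @global_lift R (fun z => U (Num.max z.1 0))
  (continuous_fun_comp (continuous_fun_fst continuous_fun_id) cU)
  (fun z => extended_diff_neq0 hI (m0 z.1)).
exists (fun t => b (t, 0)); split.
  apply: continuous_subspaceT; apply: (continuous_fun_comp _ cb).
  exact: continuous_pairl.
move=> t t0; apply/esym/thetaP; first exact: extended_diff_neq0.
by have := bU (t, 0); rewrite /= max_l.
Qed.

Lemma torsionE n : torsion n f (gamma s) (velocity gamma s) = (X n - X 0) / n%:R.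
Proof.
apply: xget_unique.
  have [I hI] := f_isotopic; have [v vP] := angle_lift_exists hI.
  by exists I, v; split => //; rewrite (angle_lift_variation n hI vP).
by move=> _ [I [v [hI vP ->]]]; rewrite (angle_lift_variation n hI vP).
Qed.

(** The segment from [A] to [B] is traversed affinely in unit time. Canonical angles depend only on
    points of the circle, so those at [A] and [B] are [X m] and [X n]. *)
Lemma tangent_angle_variation A B Theta m n :
  gamma (circle_proj A) = iter m f (gamma s) ->
  gamma (circle_proj B) = iter n f (gamma s) -> A < B ->
  tangent_angle_lift gamma A Theta -> Theta (B - A) - Theta 0 = X n - X m.
Proof.
move=> Am Bn AB [cT TP].
have AX : end_angle H W kappa A (X m).
  by apply: (end_angle_int Hk _ (XP m)); apply: (same_point_int hgamma); rewrite aP.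
have BX : end_angle H W kappa B (X n).
  by apply: (end_angle_int Hk _ (XP n)); apply: (same_point_int hgamma); rewrite aP.
pose v t := Theta (Num.max (t * (B - A)) 0).
have cv : continuous v by apply: (continuous_fun_comp _ (continuous_max0 cT)); cont.
have ca : continuous (fun t : R => A + t * (B - A)) by cont.
have := curve_variation hgamma cH Hg Hk along_kappa ca cv.
rewrite /v !mul0r mul1r addr0 subrKC maxxx max_l; last by lra.
move=> /(_ (X m) (X n)); apply => // t /andP[t0 _].
have t0' : 0 <= t * (B - A) by apply: mulr_ge0 => //; lra.
rewrite max_l//; have := TP _ t0'.
by move=> /esym /thetaP; apply; exact: velocity_neq0.
Qed.

Lemma tangent_angle_lift_exists A : exists Theta, tangent_angle_lift gamma A Theta.
Proof.
have cW : continuous (fun z : R * R => W (A + z.1)).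
  apply: (continuous_fun_comp _ (continuous_velocity hgamma)).
  by apply: continuous_funD; cont.
have [b cb bW] := global_lift cW (fun z => velocity_neq0 hgamma _).
exists (fun t => b (t, 0)); split.
  apply: continuous_subspaceT; apply: (continuous_fun_comp _ cb).
  exact: continuous_pairl.
by move=> t _; apply/esym/thetaP; [exact: velocity_neq0|exact: bW].
Qed.

Lemma angle_variationE m n :
  angle_variation gamma (iter m f (gamma s)) (iter n f (gamma s)) = X n - X m.
Proof.
apply: xget_unique; last first.
  move=> _ [A [B [T [Am Bn /andP[AB _] TP ->]]]].
  exact: tangent_angle_variation Am Bn AB TP.
(* The ceiling of [d] is the integer whose subtraction from [a n] gives the representative lying in
   [(A, A + 1]]. *)
pose A := a m; pose d := a n - A - 1; pose B := a n - (Num.ceil d)%:~R.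
have [T TP] := tangent_angle_lift_exists A.
have Bn : gamma (circle_proj B) = iter n f (gamma s).
  by rewrite /B circle_projD ?aP// rpredN intr_int.
have /andP[AB BA] : A < B <= A + 1.
  by have := ceil_itv d; rewrite intrD /B /d => /andP[? ?]; apply/andP; split; lra.
exists A, B, T; split; rewrite ?AB ?BA ?aP//.
by rewrite (tangent_angle_variation (aP m) Bn AB TP).
Qed.

End Torsion.

Theorem lemma4p3 (R : realType) (f : annulus R -> annulus R)
    (hf : negative_torsion_map f \/ positive_torsion_map f)
    (gamma : circle R -> annulus R)
    (hgamma : C1_essential_curve gamma)
    (hinv : invariant_curve f gamma)
    (s : circle R) (N : nat) (hN : (1 <= N)%N)
    (sN : circle R) (hsN : iter N f (gamma s) = gamma sN) :
  N%:R * torsion N f (gamma s) (velocity gamma s)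
  = angle_variation gamma (gamma s) (gamma sN).
Proof.
have f_isotopic : isotopic_to_id f by case: hf => -[].
have [H [cH Hg [k [_ k0 Hk]]]] := curve_lift hgamma.
have kn0 : ((k, 0) : plane R) != 0 by apply: contra k0 => /eqP[->].
have [kappa kappaP] := along_exists kn0.
have on_curve n : exists b, gamma (circle_proj b) = iter n f (gamma s).
  elim: n => [|n [b bn]]; first by have [b <-] := circle_projK s; exists b.
  have : range gamma (f (gamma (circle_proj b))).
    by rewrite -hinv; exists (gamma (circle_proj b)) => //; exists (circle_proj b).
  move=> [s' _ s'b]; have [b' b's] := circle_projK s'.
  by exists b'; rewrite b's s'b bn.
have [a aP] := choice on_curve.
have [X XP] := choice (fun n => curve_end_angle hgamma cH Hg Hk kappaP (a n)).
rewrite (torsionE f_isotopic hgamma hinv cH Hg k0 Hk kappaP aP XP).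
(* The initial point [gamma s] is read as the iterate of order 0. *)
rewrite -hsN (angle_variationE hgamma cH Hg Hk kappaP aP XP 0 N).
by rewrite mulrC divfK// pnatr_eq0 -lt0n.
Qed.
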